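(* Let $X_1,X_2,\ldots$ be i.i.d. real random variables with $0<\mathbb{E}|X_1|<\infty$ and $\mathbb{E}X_1=0$. Let $S_i=X_1+\cdots+X_i$ and $S_n^{(2)}=S_1+\cdots+S_n$, and let $p_n^{(2)}=\mathbb{P}\left(\max_{1\le k\le n}S_k^{(2)}<0\right)$ and $\overline{p}_n^{(2)}=\mathbb{P}\left(\max_{1\le k\le n}S_k^{(2)}\le 0\right)$ for $n\ge 1$, with $p_0^{(2)}=\overline{p}_0^{(2)}=1$. (a) Then, for all $n\ge 1$, $$\sum_{k=0}^n p_k^{(2)}\,\overline{p}_{n-k}^{(2)}\le c_1^2\,\frac{\mathbb{E}|S_{n+1}|}{\mathbb{E}|X_1|},$$ where $c_1\le 6\sqrt{30}$, and $c_1=2$ if $X_1$ is symmetric. (b) Furthermore, suppose that $X_1^-=-\min(X_1,0)$ satisfies the following decay assumption: there exist constants $r>0$, $\theta>1/r$ and finite $K,L$ such that for all $t>0$, $s>0$, $$\mathbb{P}(-X_1>t+s)\le K\,\mathbb{P}(-X_1>t)\,\mathbb{P}(-X_1>s)+L\,[\mathbb{P}(-X_1>r)]^{\theta(t+s)}.$$ Then the converse inequality $$\sum_{k=0}^n p_k^{(2)}\,p_{n-k}^{(2)}\ge \frac{1}{c_2}\,\frac{\mathbb{E}|S_{n+1}|}{\mathbb{E}|X_1|}$$ holds for all $n\ge 1$, for some finite $c_2=c_2(K,L,\theta,r)$. (c) Taken together, the bounds in (a) and (b) imply that, under the decay assumption of (b) and with the same constants $c_1,c_2$, for all $n\ge 1$,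 $$\frac{1}{4c_1c_2}\sqrt{\frac{\mathbb{E}|S_{n+1}|}{(n+1)\,\mathbb{E}|X_1|}}\le p_n^{(2)}\le c_1\sqrt{\frac{\mathbb{E}|S_{n+1}|}{(n+1)\,\mathbb{E}|X_1|}}.$$
   Context: $X_1$ symmetric means that $X_1$ and $-X_1$ have the same distribution. The constants $c_1$ and $c_2$ do not depend on $n$.
   Formalization: The constant c_2 is allowed to depend on P(-X_1>r) in addition to K, L, θ, r, because a single c_2(K,L,θ,r) serving all laws does not exist: it must blow up along laws with P(-X_1>r) tending to 1. *)

(* Defs.v *)
From HB Require Import structures.
From mathcomp Require Import all_boot all_order all_algebra.
From mathcomp Require Import all_classical all_reals all_analysis.

Set Implicit Arguments.
Unset Strict Implicit.
Unset Printing Implicit Defensive.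

Import Order.TTheory GRing.Theory Num.Theory.
Import numFieldNormedType.Exports.

Local Open Scope classical_set_scope.
Local Open Scope ring_scope.

(* A sequence of random variables is indexed from 0: [X i] is X_{i+1} in the
   usual one-based notation. *)

Definition mutually_independent (R : realType) (d : measure_display)
    (T : measurableType d) (P : probability T R) (X : nat -> {RV P >-> R}) :
    Prop :=
  forall (s : seq nat) (A : nat -> set R),
    uniq s -> (forall i, measurable (A i)) ->
    P (\bigcap_(i in [set` s]) (X i @^-1` A i)) =
    (\prod_(i <- s) P (X i @^-1` A i))%E.

Definition identically_distributed (R : realType) (d : measure_display)
    (T : measurableType d) (P : probability T R) (X : nat -> {RV P >-> R}) :
    Prop :=
  forall (i j : nat) (A : set R), measurable A ->
    distribution P (X i) A = distribution P (X j) A.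

Definition iid (R : realType) (d : measure_display)
    (T : measurableType d) (P : probability T R) (X : nat -> {RV P >-> R}) :
    Prop :=
  mutually_independent X /\ identically_distributed X.

Definition symmetric_rv (R : realType) (d : measure_display)
    (T : measurableType d) (P : probability T R) (Y : {RV P >-> R}) : Prop :=
  forall A : set R, measurable A ->
    distribution P Y A = P ((fun w => - Y w) @^-1` A).

Definition psum (R : realType) (T : Type) (X : nat -> T -> R)
    (n : nat) (w : T) : R :=
  \sum_(0 <= i < n) X i w.

Definition ipsum (R : realType) (T : Type) (X : nat -> T -> R)
    (n : nat) (w : T) : R :=
  \sum_(1 <= i < n.+1) psum X i w.

(* The unit of the iterated maximum is its first term, so that for [1 <= n]
   this is exactly the maximum over 1 <= k <= n. *)
Definition max_ipsum (R : realType) (T : Type) (X : nat -> T -> R)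
    (n : nat) (w : T) : R :=
  \big[Num.max/ipsum X 1 w]_(1 <= k < n.+1) ipsum X k w.

Definition persist (R : realType) (d : measure_display)
    (T : measurableType d) (P : probability T R) (X : nat -> {RV P >-> R})
    (n : nat) : R :=
  if n is 0 then 1 else fine (P [set w | max_ipsum X n w < 0]).

Definition wpersist (R : realType) (d : measure_display)
    (T : measurableType d) (P : probability T R) (X : nat -> {RV P >-> R})
    (n : nat) : R :=
  if n is 0 then 1 else fine (P [set w | max_ipsum X n w <= 0]).

Definition abs_mean (R : realType) (d : measure_display)
    (T : measurableType d) (P : probability T R) (Y : T -> R) : \bar R :=
  ('E_P[fun w => `|Y w|%R])%E.

(* E|S_n| / E|X_1|; both expectations are finite in all uses below. *)
Definition mean_ratio (R : realType) (d : measure_display)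
    (T : measurableType d) (P : probability T R) (X : nat -> {RV P >-> R})
    (n : nat) : R :=
  fine (abs_mean P (psum X n)) / fine (abs_mean P (X 0%N)).

Definition lower_tail (R : realType) (d : measure_display)
    (T : measurableType d) (P : probability T R) (Y : {RV P >-> R}) (t : R) :
    R :=
  fine (P [set w | t < - Y w]).

(* When [lower_tail Y r = 0] the last summand vanishes, since its exponent is
   positive for [0 < theta] and [0 `^ x = 0] for [0 < x]. *)
Definition tail_decay (R : realType) (d : measure_display)
    (T : measurableType d) (P : probability T R) (Y : {RV P >-> R})
    (K L theta r : R) : Prop :=
  forall t s : R, 0 < t -> 0 < s ->
    lower_tail Y (t + s) <=
      K * lower_tail Y t * lower_tail Y s
      + L * lower_tail Y r `^ (theta * (t + s)).

(* Main.v *)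
(** For a real [t] let [V_j = t + S_j].  The last time at which
    [V_0 + ... + V_(j-1)] is maximal is [i + 1] exactly when [t] lies in a
    half-open interval of length
      [gap i = (- X_i - slope (X_(i-1), ..., X_0) - slope (X_(i+1), ..., X_n))^+],
    where [slope x = max_j (x_1 + ... + (x_1 + ... + x_j)) / (j + 1)] over
    [j >= 0].  These intervals are disjoint, lie between minus the maximum and
    minus the minimum of the walk, and cover [[0, - S_(n+1)[].  Hence
      [E|S_(n+1)| / 2 <= sum_i E (gap i) <= E (range of the walk)],
    and the expected range is at most a constant times [E|S_(n+1)|]: each
    increment of the running maximum is independent of the walk after it.  The
    three terms of [gap i] are independent, [slope <= 0] is the event that all
    iterated sums are nonpositive, and [slope < - X] is a persistence event, so
    (a) follows by restricting to [slope <= 0] twice.  For (b), [E (gap i)] is bounded by a Riemann sum of tail probabilities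
    [P (- X > slope + slope' + l h)], with [h] of order [E|X|]; the decay
    assumption splits each of them into a product.  Finally (c) compares the
    convolutions of the nonincreasing sequence [p] with its values. *)

Require Import Defs.
From HB Require Import structures.
From mathcomp Require Import all_boot all_order all_algebra.
From mathcomp Require Import all_classical all_reals all_analysis.
From mathcomp Require Import measurable_realfun ring lra zify.

Set Implicit Arguments.
Unset Strict Implicit.
Unset Printing Implicit Defensive.

Import Order.TTheory GRing.Theory Num.Theory.
Import numFieldNormedType.Exports.

Local Open Scope classical_set_scope.
Local Open Scope ring_scope.

(** * Windows of the shifted walk *)

(** In (a) both factors come out as weak persistence probabilities; since [persist <= wpersist] this
    is more than the stated bound. In (b) the obstacle is the second term of the decay assumption.
    The mean of the lower tail at a slope is itself a persistence probability, but this term also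
    produces means of [e (slope)], where [e t = q ^ (theta t)] and [q = P(-X_1 > r)]. They are
    compared with [p_n] by putting steps below [- r] in front of the walk: each costs a factor [q]
    and lowers the slope by [r], so that the slope is at most [l r] with probability at most
    [p_n / q ^ l]. Against this stands the weight [e (l r) = q ^ (theta r l)], and for [0 < q < 1]
    the condition [theta > 1 / r] is exactly what makes the resulting geometric series converge. Its
    ratio depends on [q], hence so does the constant. *)

Section intervals.
Variable R : realType.
Implicit Types (a b : nat -> R) (A B : R).

Let lebesgue_itv (x y : R) :
  lebesgue_measure (`[x, y[ : set R) = (Num.max (y - x) 0)%:E.
Proof.
rewrite lebesgue_measure_itv /= lte_fin -EFinB.
case: ltP => xy; congr EFin.
  by rewrite max_l // subr_ge0 ltW.
by rewrite max_r // subr_le0.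
Qed.

Lemma length_le_cover n a b A B :
  (forall t, A <= t < B -> exists2 i, (i < n)%N & a i <= t < b i) ->
  B - A <= \sum_(i < n) Num.max (b i - a i) 0.
Proof.
move=> cover; rewrite -lee_fin -sumEFin.
under eq_bigr do rewrite -lebesgue_itv.
apply: (@le_trans _ _ (lebesgue_measure (`[A, B[ : set R))).
  by rewrite lebesgue_itv lee_fin le_max lexx.
have sub := @content_subadditive _ _ _ (@lebesgue_measure R) `[A, B[%classic
  (fun i => `[a i, b i[%classic) n.
apply: sub.
- by move=> k _; exact: measurable_itv.
- exact: measurable_itv.
- rewrite -(bigcup_mkord n (fun i => `[a i, b i[%classic)) => t /=.
  by rewrite in_itv /= => /cover[i ilt tab]; exists i => //=; rewrite in_itv.
Qed.

Lemma disjoint_length_le n a b A B : A <= B ->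
  (forall i t, (i < n)%N -> a i <= t < b i -> A <= t < B) ->
  (forall i j t, (i < n)%N -> (j < n)%N ->
    a i <= t < b i -> a j <= t < b j -> i = j) ->
  \sum_(i < n) Num.max (b i - a i) 0 <= B - A.
Proof.
move=> AB sub disj; rewrite -lee_fin -sumEFin.
under eq_bigr do rewrite -lebesgue_itv.
have mU : measurable (\big[setU/set0]_(i < n) `[a i, b i[%classic).
  by apply: bigsetU_measurable => i _; exact: measurable_itv.
rewrite -measure_semi_additive_ord //=.
- have -> : (B - A)%:E = lebesgue_measure (`[A, B[ : set R).
    by rewrite lebesgue_itv max_l // subr_ge0.
  apply: le_measure; rewrite ?inE //.
  rewrite -(bigcup_mkord n (fun i => `[a i, b i[%classic)) => t [i /= ilt].
  by rewrite !in_itv /=; exact: sub.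
- apply/trivIsetP => i j _ _ ij; rewrite -subset0 => t /=.
  rewrite !in_itv /= => -[ti tj]; move: ij.
  by rewrite (ord_inj (disj i j t (ltn_ord i) (ltn_ord j) ti tj)) eqxx.
Qed.

End intervals.

(** Ties are broken towards the last maximiser: weak inequality before it, strict after it. This
    makes the windows half-open and pairwise disjoint. *)
Lemma last_argmax (R : realType) (A : nat -> R) n :
  exists k, [/\ (k <= n)%N, forall j, (j <= k)%N -> A j <= A k
    & forall j, (k < j <= n)%N -> A j < A k].
Proof.
elim: n => [|n [k [kn kle klt]]].
  exists 0%N; split=> // j; first by rewrite leqn0 => /eqP ->.
  by move=> /andP[j0 /(leq_trans j0)].
have [lt|le] := ltP (A n.+1) (A k).
  exists k; split=> //; first exact: ltnW.
  move=> j /andP[kj]; rewrite leq_eqVlt ltnS => /predU1P[-> //|jn].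
  by apply: klt; rewrite kj.
exists n.+1; split=> //; last by move=> j /andP[] /leq_trans h /h; rewrite ltnn.
move=> j; rewrite leq_eqVlt ltnS => /predU1P[-> //|jn].
have [jk|kj] := leqP j k; first exact: le_trans (kle _ jk) le.
by apply: le_trans le; apply/ltW/klt; rewrite kj.
Qed.

(** * Slopes and gaps of finite sequences *)

Section slope.
Variable R : realType.
Implicit Types (l y : seq R).

(** The coordinates form a sequence of functions on lists, so that [psum], [ipsum] and [run] apply
    to lists as they do to random variables. *)
Definition coord (i : nat) l : R := l`_i.

(* The term [j = 0] is [0]. *)
Definition slope l : R :=
  \big[Num.max/0]_(j < (size l).+1) (ipsum coord j l / j.+1%:R).

Lemma ipsumS (T : Type) (X : nat -> T -> R) n w :
  ipsum X n.+1 w = ipsum X n w + psum X n.+1 w.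
Proof. by rewrite /ipsum big_nat_recr. Qed.

Lemma psumS (T : Type) (X : nat -> T -> R) n w :
  psum X n.+1 w = psum X n w + X n w.
Proof. by rewrite /psum big_nat_recr. Qed.

Lemma slope_leP l s :
  reflect (forall j, (j <= size l)%N -> ipsum coord j l <= s * j.+1%:R)
    (slope l <= s).
Proof.
apply: (iffP idP) => [/bigmax_leP[_ h] j jl|h].
  by have /= := h (Ordinal (jl : (j < (size l).+1)%N)) isT; rewrite ler_pdivrMr.
apply/bigmax_leP; split=> [|[j jl] _ /=]; last by rewrite ler_pdivrMr // h.
by have := h 0%N isT; rewrite mulr1 /ipsum big_geq.
Qed.

Lemma slope_ltP l s :
  reflect (forall j, (j <= size l)%N -> ipsum coord j l < s * j.+1%:R)
    (slope l < s).
Proof.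
apply: (iffP idP) => [/bigmax_ltP[_ h] j jl|h].
  by have /= := h (Ordinal (jl : (j < (size l).+1)%N)) isT; rewrite ltr_pdivrMr.
apply/bigmax_ltP; split=> [|[j jl] _ /=]; last by rewrite ltr_pdivrMr // h.
by have := h 0%N isT; rewrite mulr1 /ipsum big_geq.
Qed.

Lemma slope_ge0 l : 0 <= slope l.
Proof. exact: bigmax_ge_id. Qed.

Lemma psum_rev_take y i a : (a <= i)%N -> (i <= size y)%N ->
  psum coord a (rev (take i y)) = psum coord i y - psum coord (i - a) y.
Proof.
move=> ai iy; elim: a ai => [|a IH] ai; first by rewrite subn0 subrr /psum big_geq.
rewrite psumS IH ?(ltnW ai) // /coord nth_rev ?size_takel // nth_take; last by lia.
have -> : (i - a)%N = (i - a.+1).+1 by lia.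
by rewrite psumS /coord; ring.
Qed.

Lemma psum_drop y i a :
  psum coord a (drop i y) = psum coord (i + a) y - psum coord i y.
Proof.
elim: a => [|a IH]; first by rewrite addn0 subrr /psum big_geq.
by rewrite addnS !psumS IH /coord nth_drop; ring.
Qed.

Let area y t n : R := \sum_(0 <= j < n) (t + psum coord j y).

Let areaS y t n : area y t n.+1 = area y t n + (t + psum coord n y).
Proof. by rewrite /area big_nat_recr. Qed.

(** The last [j.+1] summands of [area y t i.+1] are the height [t + psum coord i y] minus the
    partial sums of the reversed past. The start value is itself a summand, whence [j.+1] in the
    denominators of [slope]. *)
Let back_area y t i j : (j <= i)%N -> (i <= size y)%N ->
  ipsum coord j (rev (take i y)) =
  (t + psum coord i y) * j.+1%:R - (area y t i.+1 - area y t (i - j)).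
Proof.
move=> ji iy; elim: j ji => [|j IH] ji.
  by rewrite subn0 areaS /ipsum big_geq //; ring.
rewrite ipsumS IH ?(ltnW ji) // psum_rev_take //.
have -> : (i - j)%N = (i - j.+1).+1 by lia.
by rewrite (areaS _ _ (i - j.+1)) -(natr1 j.+1); ring.
Qed.

Let fwd_area y t i j :
  ipsum coord j (drop i y) =
  area y t (i + j).+1 - area y t i - (t + psum coord i y) * j.+1%:R.
Proof.
elim: j => [|j IH].
  by rewrite addn0 areaS /ipsum big_geq //; ring.
rewrite ipsumS IH psum_drop addnS (areaS _ _ (i + j).+1) -(natr1 j.+1); ring.
Qed.

Let lo y i : R := slope (rev (take i y)) - psum coord i y.
Let hi y i : R := - y`_i - slope (drop i.+1 y) - psum coord i y.

(* The real parameter [t] shifts the starting point of the walk: for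
   [lo y i <= t < hi y i] the index [i.+1] is the last maximiser of the iterated
   sums of the shifted walk. *)
Let mem_window y t i : (i < size y)%N ->
  lo y i <= t < hi y i <->
  (forall j, (j <= i)%N -> area y t j <= area y t i.+1) /\
  (forall j, (i.+1 < j <= (size y).+1)%N -> area y t j < area y t i.+1).
Proof.
move=> iy; set T := psum coord.
have TS : T i.+1 y = T i y + y`_i by rewrite /T psumS.
have -> : lo y i <= t < hi y i
    = (slope (rev (take i y)) <= t + T i y) && (slope (drop i.+1 y) < - (t + T i.+1 y)).
  rewrite TS /lo /hi -/T.
  by congr andb; apply/idP/idP => ?; lra.
have sz : size (rev (take i y)) = i by rewrite size_rev size_takel // ltnW.
split=> [/andP[/slope_leP back /slope_ltP fwd]|[back fwd]]; first split=> j ji.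
- have := back (i - j)%N; rewrite sz => /(_ (leq_subr _ _)).
  rewrite (back_area t) ?leq_subr ?(ltnW iy) // subKn //.
  by rewrite lerBlDr lerDl subr_ge0.
- have [ij jy] := andP ji.
  have := fwd (j - i.+2)%N; rewrite size_drop => /(_ ltac:(lia)).
  rewrite (fwd_area _ t) (_ : (i.+1 + (j - i.+2)).+1 = j); last by lia.
  by rewrite /T; lra.
- apply/andP; split.
    apply/slope_leP => j; rewrite sz => ji.
    rewrite (back_area t) ?(ltnW iy) //.
    by have := back (i - j)%N (leq_subr _ _); rewrite /T; lra.
  apply/slope_ltP => j; rewrite size_drop => jy.
  rewrite (fwd_area _ t).
  by have := fwd (i.+1 + j).+1 ltac:(lia); rewrite /T; lra.
Qed.

Definition gap y i : R :=
  Num.max (- y`_i - slope (rev (take i y)) - slope (drop i.+1 y)) 0.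

Let gapE y i : gap y i = Num.max (hi y i - lo y i) 0.
Proof. by rewrite /gap /hi /lo; congr Num.max; ring. Qed.

Lemma drop_le_sum_gap y n : size y = n.+1 ->
  - psum coord n.+1 y <= \sum_(i < n.+1) gap y i.
Proof.
move=> sy; under eq_bigr do rewrite gapE.
rewrite -[leLHS]subr0; apply: (@length_le_cover _ _ (lo y) (hi y)) => t /andP[t0 tT].
have [k [kn kle klt]] := last_argmax (area y t) n.+2.
(* The first summand [t] is nonnegative and the last one, [t + psum coord n.+1 y], is negative, so
   the last maximiser is neither [0] nor [n.+2]. *)
have A1 : area y t 0 <= area y t 1.
  by rewrite areaS /area big_geq // /psum big_geq //; lra.
have An : area y t n.+2 < area y t n.+1 by rewrite (areaS _ _ n.+1); lra.
case: k kn kle klt => [|k] kn kle klt.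
  by have := klt 1%N isT; lra.
have kn1 : (k < n.+1)%N.
  rewrite ltn_neqAle -ltnS kn andbT; apply/eqP => kE.
  by have := kle n.+1; rewrite kE leqnSn => /(_ isT); lra.
have ky : (k < size y)%N by rewrite sy.
exists k => //; apply/(mem_window t ky).
split=> j jk; first by apply: kle; rewrite ltnW.
by apply: klt; rewrite -sy.
Qed.

Lemma sum_gap_le_range y n (u v : R) : size y = n.+1 ->
  (forall j, (j <= n.+1)%N -> - v <= psum coord j y <= u) ->
  \sum_(i < n.+1) gap y i <= u + v.
Proof.
move=> sy bnd; under eq_bigr do rewrite gapE.
rewrite addrC -[u]opprK; apply: (@disjoint_length_le _ _ (lo y) (hi y)).
- by have := bnd 0%N isT; lra.
- move=> i t ilt /mem_window[|up down]; first by rewrite sy.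
  (* The two neighbours of the maximiser suffice: they give [t + psum coord i y >= 0] and
     [t + psum coord i.+1 y < 0]. *)
  have := up i (leqnn _); have := down i.+2 ltac:(lia).
  rewrite !areaS; have := bnd i (ltnW ilt); have := bnd i.+1 ilt.
  by lra.
- move=> i j t ilt jlt /mem_window[|upi downi]; first by rewrite sy.
  move=> /mem_window[|upj downj]; first by rewrite sy.
  have [ij|ji|//] := ltngtP i j.
    by have := lt_le_trans (downi j.+1 ltac:(lia)) (upj i.+1 ij); rewrite ltxx.
  by have := lt_le_trans (downj i.+1 ltac:(lia)) (upi j.+1 ji); rewrite ltxx.
Qed.

Lemma ipsum_cons x l j :
  ipsum coord j.+1 (x :: l) = x * j.+1%:R + ipsum coord j l.
Proof.
elim: j => [|j IH].
  by rewrite ipsumS /ipsum big_geq // big_geq // /psum big_nat1 /coord /=; ring.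
rewrite ipsumS IH ipsumS /psum big_nat_recl // -(natr1 j.+1) /coord /=; ring.
Qed.

(** A step put in front enters the iterated sum at [j.+1] with weight [j.+1], while the denominator
    grows to [j.+2]; a larger denominator only helps once the bound is nonnegative. *)
Lemma slope_cons_le x l : slope (x :: l) <= Num.max 0 (slope l + x).
Proof.
apply/slope_leP => -[|j] /=.
  by rewrite /ipsum big_geq // mulr1 le_max lexx.
rewrite ltnS ipsum_cons => jl; have /slope_leP/(_ j jl) := lexx (slope l).
have j1 : (1 : R) <= j.+1%:R by rewrite ler1n.
by rewrite -(natr1 j.+1); case: (lerP 0 (slope l + x)) => ?; nra.
Qed.

Lemma slope_cat_ge l l' : slope l <= slope (l ++ l').
Proof.
apply/slope_leP => j jl; have /slope_leP/(_ j) := lexx (slope (l ++ l')).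
rewrite size_cat (leq_trans jl (leq_addr _ _)) => /(_ isT); apply: le_trans.
rewrite le_eqVlt; apply/orP; left; apply/eqP; apply: eq_big_nat => a /andP[_ aj].
apply: eq_big_nat => i /andP[_ ia]; rewrite /coord nth_cat.
by rewrite (leq_trans ia (leq_trans _ jl)).
Qed.

End slope.

(** * Independence and blocks *)

Section pi_system_extension.
Local Open Scope ereal_scope.
Context (R : realType) d (T : measurableType d) (P : probability T R).
Context d' (E : measurableType d') (G : set (set E)).
Hypotheses (GE : measurable = <<s G >>) (GI : setI_closed G) (GT : G setT).
Variables (U : T -> E) (mU : measurable_fun setT U).

#[local] HB.instance Definition _ := @isMeasurableFun.Build _ _ _ _ U mU.

Lemma law_unique (P' : probability T R) (V : T -> E)
    (mV : measurable_fun setT V) :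
  (forall A, G A -> P (U @^-1` A) = P' (V @^-1` A)) ->
  forall A, measurable A -> P (U @^-1` A) = P' (V @^-1` A).
Proof.
move=> UV A mA.
pose V' : {mfun T >-> E} := mfun_Sub (mem_set mV).
apply: (measure_unique G (fun=> setT) GE GI _ _ (distribution P U)
  (distribution P' V')) => //.
- by rewrite bigcup_const.
- by move=> _; rewrite /= /distribution /pushforward preimage_setT probability_setT ltry.
Qed.

(** As functions of [A] both sides are finite measures: the restriction of [P] to [D] pushed forward
    by [U], and the law of [U] scaled by [P D]. They agree on the pi-system [G]. *)
Lemma independent_extension (D : set T) : measurable D ->
  (forall A, G A -> P (U @^-1` A `&` D) = P (U @^-1` A) * P D) ->
  forall A, measurable A -> P (U @^-1` A `&` D) = P (U @^-1` A) * P D.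
Proof.
move=> mD UD A mA.
have PD : P D = (fine (P D))%:E by rewrite fineK // fin_num_measure.
pose c := NngNum (fine_ge0 (measure_ge0 P D)).
rewrite PD muleC; apply: (measure_unique G (fun=> setT) GE GI _ _
  (pushforward (mrestr P mD) U) (mscale c (distribution P U))) => //.
- by rewrite bigcup_const.
- by move=> B GB; rewrite /= /pushforward /mrestr UD // /mscale /= -PD muleC.
- move=> _; rewrite /= /pushforward /mrestr preimage_setT setTI.
  by rewrite PD ltry.
Qed.

End pi_system_extension.

Section independent_maps.
Local Open Scope ereal_scope.
Context (R : realType) d (T : measurableType d) (P : probability T R).
Context d1 d2 (E1 : measurableType d1) (E2 : measurableType d2).

Definition independent_maps (U : T -> E1) (V : T -> E2) :=
  forall A B, measurable A -> measurable B ->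
    P (U @^-1` A `&` V @^-1` B) = P (U @^-1` A) * P (V @^-1` B).

Variables (U : T -> E1) (V : T -> E2).
Hypotheses (mU : measurable_fun setT U) (mV : measurable_fun setT V).
Hypothesis UV : independent_maps U V.

Let U' : {mfun T >-> E1} := mfun_Sub (mem_set mU).
Let V' : {mfun T >-> E2} := mfun_Sub (mem_set mV).

(** The joint law is the product of the two laws, so Tonelli applies; the variable [w'] acts as an
    independent copy of [w]. *)
Lemma integral_independent (F : E1 * E2 -> \bar R) :
  measurable_fun setT F -> (forall z, 0 <= F z) ->
  \int[P]_w F (U w, V w) = \int[P]_w \int[P]_w' F (U w, V w').
Proof.
move=> mF F0.
pose UV' : {mfun T >-> (E1 * E2)%type} :=
  mfun_Sub (mem_set (measurable_fun_pair mU mV)).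
transitivity (\int[distribution P UV']_z F z).
  by rewrite ge0_integral_distribution.
transitivity (\int[distribution P U' \x distribution P V']_z F z).
  apply: eq_measure_integral => A mA _; apply/esym.
  by apply: product_measure_unique => //= B C mB mC; exact: UV.
rewrite fubini_tonelli1 // ge0_integral_distribution //.
- apply: eq_integral => w _ /=.
  rewrite /fubini_F /= ge0_integral_distribution //.
  exact: measurableT_comp.
- exact: measurable_fun_fubini_tonelli_F.
- by move=> x; exact: integral_ge0.
Qed.

End independent_maps.

Section rectangles.
Context (R : realType) (n : nat).

Definition rectangles : set (set (n.-tuple R)) :=
  [set A | exists2 B : 'I_n -> set R, (forall i, measurable (B i)) &
    A = [set t | forall i, B i (tnth t i)]].

Lemma rectanglesT : rectangles setT.
Proof. by exists (fun=> setT) => //; apply/seteqP; split. Qed.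

Lemma rectanglesI : setI_closed rectangles.
Proof.
move=> _ _ [B mB ->] [C mC ->]; exists (fun i => B i `&` C i).
  by move=> i; exact: measurableI.
by apply/seteqP; split=> t /= => [[h1 h2] i|h]; split=> // i; have [] := h i.
Qed.

Lemma measurable_rectangles : measurable = <<s rectangles >>.
Proof.
apply/seteqP; split; last first.
  apply: smallest_sub; first exact: sigma_algebra_measurable.
  move=> _ [B mB ->].
  rewrite (_ : [set _ | _] =
      \bigcap_(i in [set: 'I_n]) ((fun t => tnth t i) @^-1` B i)); last first.
    by apply/seteqP; split=> t /= h i; [move=> _|]; exact: h.
  apply: fin_bigcap_measurable => // i _.
  by rewrite -[X in measurable X]setTI; exact: measurable_tnth.
apply: smallest_sub; first exact: smallest_sigma_algebra.
move=> A; rewrite -bigcup_seq /= => -[i _ [C mC <-]]; rewrite setTI.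
apply: sub_sigma_algebra; exists (fun j => if j == i then C else setT).
  by move=> j; case: ifP.
apply/seteqP; split=> t /= h; last by have := h i; rewrite eqxx.
by move=> j; case: eqVneq => // ->.
Qed.

End rectangles.

Section blocks.
Local Open Scope ereal_scope.
Context (R : realType) d (T : measurableType d) (P : probability T R).

Definition block (X : nat -> {RV P >-> R}) (s : seq nat) (w : T) : seq R :=
  [seq X i w | i <- s].

Lemma size_block X s w : size (block X s w) = size s.
Proof. exact: size_map. Qed.

Definition tblock (X : nat -> {RV P >-> R}) n (s : n.-tuple nat) (w : T) :
  n.-tuple R := [tuple of block X s w].

Lemma measurable_tblock X n (s : n.-tuple nat) : measurable_fun setT (tblock X s).
Proof.
apply/measurable_fun_tnthP => i.
rewrite (_ : _ \o _ = X (tnth s i)) //.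
by apply/funext => w /=; rewrite tnth_map.
Qed.

Lemma tblock_rectangle X n (s : n.-tuple nat) A : uniq s -> rectangles A ->
  exists2 B : nat -> set R, (forall i, measurable (B i)) &
    tblock X s @^-1` A = \bigcap_(i in [set` s]) (X i @^-1` B i).
Proof.
move=> us [B mB ->].
exists (fun j => if insub (index j s) is Some i then B i else setT).
  by move=> j; case: insubP => [i _ _|_].
apply/seteqP; split=> w /= h.
  move=> j /= js; case: insubP => [i _ ij|//].
  have -> : j = tnth s i by rewrite (tnth_nth 0%N) ij nth_index.
  by have := h i; rewrite tnth_map.
move=> i; have := h (tnth s i) (mem_tnth i s).
have -> : index (tnth s i) s = i by rewrite (tnth_nth 0%N) index_uniq ?size_tuple.
by rewrite valK /= tnth_map.
Qed.

(** On rectangles this is the product formula over [s ++ s']. The extension from rectangles is then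
    made in one block at a time, the event of the other block being fixed. *)
Lemma independent_tblock X m n (s : m.-tuple nat) (s' : n.-tuple nat) :
  mutually_independent X -> uniq (s ++ s') ->
  independent_maps P (tblock X s) (tblock X s').
Proof.
move=> Xind us; have := us; rewrite cat_uniq => /and3P[us1 /hasPn ss' us2].
have rect A B : rectangles A -> rectangles B ->
    P (tblock X s @^-1` A `&` tblock X s' @^-1` B) =
    P (tblock X s @^-1` A) * P (tblock X s' @^-1` B).
  move=> /(tblock_rectangle X us1)[A' mA' ->].
  move=> /(tblock_rectangle X us2)[B' mB' ->].
  pose C i := if i \in tval s then A' i else B' i.
  have mC i : measurable (C i) by rewrite /C; case: ifP.
  have -> : \bigcap_(i in [set` s]) (X i @^-1` A' i) =
      \bigcap_(i in [set` s]) (X i @^-1` C i).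
    by apply: eq_bigcapr => i /= si; rewrite /C si.
  have -> : \bigcap_(i in [set` s']) (X i @^-1` B' i) =
      \bigcap_(i in [set` s']) (X i @^-1` C i).
    by apply: eq_bigcapr => i /= si; rewrite /C (negbTE (ss' _ si)).
  rewrite -bigcap_setU (Xind _ _ us1 mC) (Xind _ _ us2 mC) -big_cat /=.
  rewrite -Xind // (_ : [set` _ ++ _] = [set` s] `|` [set` s']) //.
  by apply/seteqP; split=> i /=; rewrite mem_cat => /orP.
move=> A B mA mB.
have mpre k (r : k.-tuple nat) C : measurable C -> measurable (tblock X r @^-1` C).
  by move=> mC; rewrite -[X in measurable X]setTI; exact: measurable_tblock.
apply: (independent_extension (@measurable_rectangles R m)
  (@rectanglesI R m) (@rectanglesT R m) (measurable_tblock X s) (mpre _ _ _ mB))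
  => // {mA}A rA.
rewrite setIC muleC; apply: (independent_extension (@measurable_rectangles R n)
  (@rectanglesI R n) (@rectanglesT R n) (measurable_tblock X s')) => //.
  apply: mpre; rewrite measurable_rectangles; exact: sub_sigma_algebra.
by move=> {mB}B rB; rewrite setIC muleC rect.
Qed.

(** Two index lists give invariance under shifts and reversal; two sequences allow the comparison of
    a symmetric walk with its reflection. *)
Lemma tblock_law X Y n (s s' : n.-tuple nat) A :
  mutually_independent X -> mutually_independent Y ->
  (forall i j B, measurable B -> distribution P (X i) B = distribution P (Y j) B) ->
  uniq s -> uniq s' -> measurable A ->
  P (tblock X s @^-1` A) = P (tblock Y s' @^-1` A).
Proof.
move=> Xind Yind XY us us' mA.
apply: (law_unique (@measurable_rectangles R n) (@rectanglesI R n)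
  (@rectanglesT R n) (measurable_tblock X s) (measurable_tblock Y s')) => //.
move=> {mA}A rA.
have [B mB AB] := rA.
pose B' (r : n.-tuple nat) j := if insub (index j r) is Some i then B i else setT.
have key Z (r : n.-tuple nat) : mutually_independent Z -> uniq r ->
    P (tblock Z r @^-1` A) = \prod_(i < n) P (Z (tnth r i) @^-1` B i).
  move=> Zind ur.
  have rB i : B' r (tnth r i) = B i.
    rewrite /B' (tnth_nth 0%N) index_uniq ?size_tuple //.
    by rewrite valK.
  have mB' i : measurable (B' r i) by rewrite /B'; case: insubP => [j _ _|_].
  transitivity (P (\bigcap_(i in [set` r]) (Z i @^-1` B' r i))).
    congr (P _); rewrite AB; apply/seteqP; split=> w /= h.
      by move=> j /= /tnthP[i ->]; rewrite rB; have := h i; rewrite tnth_map.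
    by move=> i; have := h (tnth r i) (mem_tnth i r); rewrite rB tnth_map.
  rewrite Zind // big_tuple.
  by apply: eq_bigr => i _; rewrite -rB.
rewrite !key //; apply: eq_bigr => i _; exact: XY.
Qed.

End blocks.

(** * Means *)

Section mean.
Local Open Scope ereal_scope.
Context (R : realType) d (T : measurableType d) (P : probability T R).
Implicit Types (f g : T -> R) (b : T -> bool).

Definition mean f : \bar R := \int[P]_w (f w)%:E.

Lemma mean_ge0 f : (forall w, 0 <= f w)%R -> 0 <= mean f.
Proof. by move=> f0; apply: integral_ge0 => w _; rewrite lee_fin. Qed.

Lemma le_mean f g : measurable_fun setT f -> measurable_fun setT g ->
  (forall w, 0 <= f w)%R -> (forall w, f w <= g w)%R -> mean f <= mean g.
Proof.
move=> mf mg f0 fg; apply: ge0_le_integral => //.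
- by move=> w _; rewrite lee_fin.
- exact/measurable_EFinP.
- exact/measurable_EFinP.
- by move=> w _; rewrite lee_fin.
Qed.

Lemma meanD f g : measurable_fun setT f -> measurable_fun setT g ->
  (forall w, 0 <= f w)%R -> (forall w, 0 <= g w)%R ->
  mean (fun w => f w + g w)%R = mean f + mean g.
Proof.
move=> mf mg f0 g0; rewrite /mean -ge0_integralD //.
- by move=> w _; rewrite lee_fin.
- exact/measurable_EFinP.
- by move=> w _; rewrite lee_fin.
- exact/measurable_EFinP.
Qed.

Lemma meanZ k f : (0 <= k)%R -> measurable_fun setT f ->
  (forall w, 0 <= f w)%R -> mean (fun w => k * f w)%R = k%:E * mean f.
Proof.
move=> k0 mf f0; rewrite /mean -ge0_integralZl_EFin //.
- by move=> w _; rewrite lee_fin.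
- exact/measurable_EFinP.
Qed.

Lemma mean_sum (I : Type) (r : seq I) (f : I -> T -> R) :
  (forall i, measurable_fun setT (f i)) -> (forall i w, 0 <= f i w)%R ->
  mean (fun w => \sum_(i <- r) f i w)%R = \sum_(i <- r) mean (f i).
Proof.
move=> mf f0; rewrite /mean -ge0_integral_sum //.
- by apply: eq_integral => w _; rewrite sumEFin.
- by move=> i; exact/measurable_EFinP.
- by move=> i w _; rewrite lee_fin.
Qed.

Lemma mean_cst k : mean (fun=> k) = k%:E.
Proof. by rewrite /mean integral_cst //= probability_setT mule1. Qed.

Lemma measurable_set_pred b : measurable_fun setT b -> measurable [set w | b w].
Proof.
move=> mb; rewrite (_ : [set _ | _] = setT `&` b @^-1` [set true]).
  exact: mb.
by rewrite setTI; apply/seteqP; split.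
Qed.

Let natr_predE b : (fun w => (b w)%:R : R) = \1_[set w | b w].
Proof.
apply/funext => w; rewrite indicE (_ : (w \in [set w | b w]) = b w) //.
by apply/idP/idP; rewrite inE.
Qed.

Lemma measurable_natr_pred b : measurable_fun setT b ->
  measurable_fun setT (fun w => (b w)%:R : R).
Proof.
by move=> mb; rewrite natr_predE; apply: measurable_indic; exact: measurable_set_pred.
Qed.

Lemma mean_pred b : measurable_fun setT b ->
  mean (fun w => (b w)%:R)%R = P [set w | b w].
Proof.
move=> mb; rewrite /mean.
have -> : (fun w => ((b w)%:R : R)%:E) = (fun w => (\1_[set w | b w] w : R)%:E).
  by rewrite -natr_predE.
by rewrite integral_indic // ?setIT //; exact: measurable_set_pred.
Qed.

Lemma mean_bounded_fin f k : measurable_fun setT f ->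
  (forall w, 0 <= f w <= k)%R -> mean f \is a fin_num.
Proof.
move=> mf fk; rewrite ge0_fin_numE; last by apply: mean_ge0 => w; case/andP: (fk w).
apply: (@le_lt_trans _ _ (mean (fun=> k))); last by rewrite mean_cst ltry.
by apply: le_mean => // w; case/andP: (fk w).
Qed.

(** Pointwise, twice the positive part of [f] is its absolute value plus [f]. *)
Lemma mean_positive_part f : P.-integrable setT (EFin \o f) ->
  \int[P]_w (f w)%:E = 0 ->
  2%:E * mean (fun w => Num.max (f w) 0)%R = mean (fun w => `|f w|)%R.
Proof.
move=> intf f0.
have mf : measurable_fun setT f by have /integrableP[/measurable_EFinP] := intf.
have mM : measurable_fun setT (fun w => Num.max (f w) 0)%R by exact: measurable_maxr.
rewrite -meanZ //; last by move=> w; rewrite le_max lexx orbT.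
transitivity (\int[P]_w (`|f w|%:E + (f w)%:E)).
  apply: eq_integral => w _; rewrite -EFinD; congr EFin.
  by case: (leP 0%R (f w)) => h; [rewrite ger0_norm // mulr_natl | rewrite ltr0_norm // mulr0 addNr].
rewrite integralD //; last exact: integrable_norm.
by rewrite f0 adde0.
Qed.

End mean.

Section independence.
Local Open Scope ereal_scope.
Context (R : realType) d (T : measurableType d) (P : probability T R).
Context d1 d2 (E1 : measurableType d1) (E2 : measurableType d2).

Lemma mean_independent (U : T -> E1) (V : T -> E2) (F : E1 * E2 -> R) :
  measurable_fun setT U -> measurable_fun setT V -> independent_maps P U V ->
  measurable_fun setT F -> (forall z, 0 <= F z)%R ->
  mean P (fun w => F (U w, V w)) =
  \int[P]_w mean P (fun w' => F (U w, V w')).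
Proof.
move=> mU mV UV mF F0.
rewrite /mean (integral_independent mU mV UV (F := EFin \o F)) //.
exact/measurable_EFinP.
Qed.

Lemma mean_mul_independent (U : T -> E1) (V : T -> E2) (f : E1 -> R) (g : E2 -> R) :
  measurable_fun setT U -> measurable_fun setT V -> independent_maps P U V ->
  measurable_fun setT f -> measurable_fun setT g ->
  (forall x, 0 <= f x)%R -> (forall x, 0 <= g x)%R ->
  mean P (fun w => f (U w) * g (V w))%R =
  mean P (fun w => f (U w)) * mean P (fun w => g (V w)).
Proof.
move=> mU mV UV mf mg f0 g0.
have mfU : measurable_fun setT (fun w => f (U w)) by exact: measurableT_comp.
have mgV : measurable_fun setT (fun w => g (V w)) by exact: measurableT_comp.
rewrite (mean_independent (F := fun z => (f z.1 * g z.2)%R)) //; first last.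
- by move=> z; rewrite mulr_ge0.
- by apply: measurable_funM; apply: measurableT_comp.
transitivity (\int[P]_w ((f (U w))%:E * mean P (fun w' => g (V w')))).
  by apply: eq_integral => w _ /=; rewrite -meanZ.
rewrite ge0_integralZr //; first exact/measurable_EFinP.
- by move=> w _; rewrite lee_fin.
- exact: mean_ge0.
Qed.

End independence.

Section jensen.
Local Open Scope ereal_scope.
Context (R : realType) d (T : measurableType d) (P : probability T R).

(** Jensen's inequality with [U] frozen: since [V] is centered, [U w] is the integral of
    [U w + V w'] over [w']. *)
Lemma mean_norm_le_add (U V : T -> R) :
  measurable_fun setT U -> independent_maps P U V ->
  P.-integrable setT (EFin \o V) -> \int[P]_w (V w)%:E = 0 ->
  mean P (fun w => `|U w|)%R <= mean P (fun w => `|U w + V w|)%R.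
Proof.
move=> mU UV intV V0.
have mV : measurable_fun setT V by have /integrableP[/measurable_EFinP] := intV.
have mF : measurable_fun setT (fun z : R * R => `|z.1 + z.2|)%R.
  by apply: measurableT_comp => //; exact: measurable_funD.
rewrite (mean_independent (F := fun z : R * R => `|z.1 + z.2|%R)) //.
apply: ge0_le_integral => //.
- by apply/measurable_EFinP; exact: measurableT_comp.
- apply: (measurableT_comp (f := fun x : R => \int[P]_w' (`|x + V w'|%R)%:E)) => //.
  pose G z : \bar R := (`|z.1 + V z.2|%R)%:E.
  apply: (@measurable_fun_fubini_tonelli_F _ _ _ _ _ P G).
    apply/measurable_EFinP/measurableT_comp => //; apply: measurable_funD => //.
    exact: measurableT_comp.
  by move=> z; rewrite lee_fin.
- move=> w _; have intUV : P.-integrable setT (fun w' => (U w + V w')%:E).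
    rewrite (_ : (fun _ => _) = (fun w' => (U w)%:E + (V w')%:E)) //.
    by apply: integrableD => //; exact: finite_measure_integrable_cst.
  have -> : (`|U w|%R)%:E = `|\int[P]_w' (U w + V w')%:E|.
    under eq_integral do rewrite EFinD.
    rewrite integralD //; last exact: finite_measure_integrable_cst.
    by rewrite V0 adde0 integral_cst //= probability_setT mule1.
  apply: (le_abse_integral P (f := fun w' => (U w + V w')%:E)) => //.
  by have /integrableP[] := intUV.
Qed.

End jensen.

(** * Measurability of functions of finite sequences *)

Section measurability.
Context (R : realType) d (E : measurableType d).
Implicit Types (X : nat -> E -> R).

Lemma measurable_bigmax (I : Type) (r : seq I) x0 (F : I -> E -> R) :
  (forall i, measurable_fun setT (F i)) ->
  measurable_fun setT (fun e => \big[Num.max/x0]_(i <- r) F i e).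
Proof.
move=> mF; elim: r => [|i r IH].
  by under eq_fun do rewrite big_nil; exact: measurable_cst.
under eq_fun do rewrite big_cons; exact: measurable_maxr.
Qed.

Lemma measurable_psum X n : (forall k, measurable_fun setT (X k)) ->
  measurable_fun setT (psum X n).
Proof. by move=> mX; apply: measurable_sum. Qed.

Lemma measurable_ipsum X n : (forall k, measurable_fun setT (X k)) ->
  measurable_fun setT (ipsum X n).
Proof. by move=> mX; apply: measurable_sum => k; exact: measurable_psum. Qed.

Lemma measurable_slope (L : E -> seq R) n : (forall e, size (L e) = n) ->
  (forall k, measurable_fun setT (fun e => (L e)`_k)) ->
  measurable_fun setT (fun e => slope (L e)).
Proof.
move=> sL mL.
have -> : (fun e => slope (L e)) = (fun e =>
    \big[Num.max/0]_(j < n.+1) (ipsum (fun k e => (L e)`_k) j e / j.+1%:R)).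
  by apply/funext => e; rewrite /slope sL.
apply: measurable_bigmax => j; apply: measurable_funM => //.
exact: measurable_ipsum.
Qed.

End measurability.

Section measurable_seq.
Context (R : realType).

(** The sigma-algebra lives on tuples, so measurability on lists is asked length by length; a block
    has the fixed length of its index list. *)
Definition measurable_seq d (E : measurableType d) (f : seq R -> E) :=
  forall n, measurable_fun setT (fun t : n.-tuple R => f t).

Lemma measurable_coord k : measurable_seq (fun l : seq R => l`_k).
Proof.
move=> n; have [kn|nk] := ltnP k n.
  rewrite (_ : (fun _ => _) = (fun t : n.-tuple R => tnth t (Ordinal kn))).
    exact: measurable_tnth.
  by apply/funext => t; rewrite (tnth_nth 0).
under eq_fun do rewrite nth_default ?size_tuple //.
exact: measurable_cst.
Qed.

Lemma measurable_seq_psum k : measurable_seq (psum (@coord R) k).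
Proof. by move=> n; apply: measurable_psum => i; exact: measurable_coord. Qed.

Lemma measurable_seq_slope : measurable_seq (@slope R).
Proof.
move=> n; apply: (measurable_slope (n := n)) => [t|k]; first by rewrite size_tuple.
exact: measurable_coord.
Qed.

Lemma measurable_seq_sum : measurable_seq (fun l : seq R => \sum_(x <- l) x).
Proof.
move=> n; under eq_fun do rewrite big_tuple.
by apply: measurable_sum => i; exact: measurable_tnth.
Qed.

End measurable_seq.

Section blocks.
Context (R : realType) d (T : measurableType d) (P : probability T R).
Implicit Types (X Y : nat -> {RV P >-> R}) (s : seq nat).

Lemma measurable_block X d' (E : measurableType d') (f : seq R -> E) s :
  measurable_seq f -> measurable_fun setT (fun w => f (block X s w)).
Proof.
move=> mf; apply: (measurableT_comp (mf (size s)) (measurable_tblock X (in_tuple s))).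
Qed.

Lemma independent_blocks X d1 (E1 : measurableType d1) (f : seq R -> E1)
    d2 (E2 : measurableType d2) (g : seq R -> E2) s s' :
  mutually_independent X -> measurable_seq f -> measurable_seq g ->
  uniq (s ++ s') ->
  independent_maps P (fun w => f (block X s w)) (fun w => g (block X s' w)).
Proof.
move=> Xind mf mg us A B mA mB.
have mA' := mf (size s) measurableT A mA; have mB' := mg (size s') measurableT B mB.
rewrite setTI in mA'; rewrite setTI in mB'.
exact: (independent_tblock (s := in_tuple s) (s' := in_tuple s') Xind us mA' mB').
Qed.

Definition same_marginals X Y := forall i j B, measurable B ->
  distribution P (X i) B = distribution P (Y j) B.

Lemma mean_block X Y (f : seq R -> R) s s' :
  mutually_independent X -> mutually_independent Y -> same_marginals X Y ->
  measurable_seq f -> (forall l, 0 <= f l) ->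
  uniq s -> uniq s' -> size s = size s' ->
  mean P (fun w => f (block X s w)) = mean P (fun w => f (block Y s' w)).
Proof.
move=> Xind Yind XY mf f0 us us' ss'.
have key n (r : n.-tuple nat) (Z : nat -> {RV P >-> R}) : mean P (fun w => f (block Z r w)) =
    (\int[distribution P (mfun_Sub (mem_set (measurable_tblock Z r)) :
        {mfun T >-> (n.-tuple R)})]_t (f t)%:E)%E.
  have mfE : measurable_fun setT (fun t : n.-tuple R => (f t)%:E).
    by apply/measurable_EFinP; exact: mf.
  by rewrite ge0_integral_distribution // => t; rewrite lee_fin.
have := key (size s) (in_tuple s) X => /= ->.
have sz : size s' == size s by rewrite ss'.
have := key (size s) (Tuple sz) Y => /= ->.
apply: eq_measure_integral => A mA _.
exact: (tblock_law (s := in_tuple s) (s' := Tuple sz) Xind Yind XY us us' mA).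
Qed.

Lemma prob_block X Y (b : seq R -> bool) s s' :
  mutually_independent X -> mutually_independent Y -> same_marginals X Y ->
  measurable_seq b -> uniq s -> uniq s' -> size s = size s' ->
  P [set w | b (block X s w)] = P [set w | b (block Y s' w)].
Proof.
move=> Xind Yind XY mb us us' ss'.
rewrite -!mean_pred; [|exact: measurable_block..].
apply: (mean_block (f := fun l => (b l)%:R)) => // n.
exact: (measurable_natr_pred (mb n)).
Qed.

Lemma block_iota_coord X n k w : (k < n)%N -> (block X (iota 0 n) w)`_k = X k w.
Proof. by move=> kn; rewrite (nth_map 0%N) ?size_iota // nth_iota. Qed.

Lemma psum_block X n k w : (k <= n)%N ->
  psum (@coord R) k (block X (iota 0 n) w) = psum X k w.
Proof.
move=> kn; apply: eq_big_nat => i /= ik.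
by rewrite /coord block_iota_coord // (leq_trans ik).
Qed.

Lemma ipsum_block X n k w : (k <= n)%N ->
  ipsum (@coord R) k (block X (iota 0 n) w) = ipsum X k w.
Proof.
move=> kn; apply: eq_big_nat => i /andP[_ ik].
by rewrite psum_block // (leq_trans _ kn).
Qed.

Lemma psum_sum_block X n w : psum X n w = \sum_(x <- block X (iota 0 n) w) x.
Proof. by rewrite /block big_map /psum /index_iota subn0. Qed.

Lemma psum_cat X m n w : (m <= n)%N ->
  psum X n w = psum X m w + \sum_(x <- block X (iota m (n - m)) w) x.
Proof. by move=> mn; rewrite /block big_map /psum (@big_cat_nat _ _ _ m 0 n). Qed.

End blocks.

(** * The running maximum *)

Section running_maximum.
Context (R : realType).

Fixpoint run (E : Type) (X : nat -> E -> R) n (w : E) : R :=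
  if n is m.+1 then Num.max (run X m w) (psum X n w) else 0.

Lemma run_ge0 (E : Type) (X : nat -> E -> R) n w : 0 <= run X n w.
Proof. by elim: n => //= n IH; rewrite le_max IH. Qed.

Lemma psum_le_run (E : Type) (X : nat -> E -> R) n j w :
  (j <= n)%N -> psum X j w <= run X n w.
Proof.
elim: n => [|n IH]; first by rewrite leqn0 => /eqP ->; rewrite /psum big_geq.
by rewrite leq_eqVlt ltnS le_max => /predU1P[->|/IH ->] //; rewrite lexx orbT.
Qed.

Lemma run_block d (T : measurableType d) (P : probability T R)
    (X : nat -> {RV P >-> R}) n k w : (k <= n)%N ->
  run (@coord R) k (block X (iota 0 n) w) = run X k w.
Proof.
elim: k => //= k IH kn; rewrite IH ?psum_block //; exact: ltnW.
Qed.

Lemma measurable_run d (E : measurableType d) (X : nat -> E -> R) n :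
  (forall k, measurable_fun setT (X k)) -> measurable_fun setT (run X n).
Proof.
move=> mX; elim: n => /= [|n IH]; first exact: measurable_cst.
by apply: measurable_maxr => //; exact: measurable_psum.
Qed.

Lemma measurable_seq_run n : measurable_seq (run (@coord R) n).
Proof.
move=> m; elim: n => /= [|n IH]; first exact: measurable_cst.
by apply: measurable_maxr => //; exact: measurable_seq_psum.
Qed.

(* An increment of the running maximum is a record, and a record at a time [j.+1]
   with [psum X m w - psum X j.+1 w >= - c] is at most [psum X m w + c]. *)
Lemma sum_record_le (E : Type) (X : nat -> E -> R) m (c : R) w : 0 <= c ->
  \sum_(j < m) (run X j.+1 w - run X j w)
      * (- c <= psum X m w - psum X j.+1 w)%R%:R
    <= Num.max (psum X m w + c) 0.
Proof.
move=> c0; set B := Num.max _ _.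
suff H k : (k <= m)%N -> \sum_(j < k) (run X j.+1 w - run X j w)
      * (- c <= psum X m w - psum X j.+1 w)%R%:R <= Num.min (run X k w) B.
  by apply: le_trans (H m (leqnn _)) _; rewrite ge_min lexx orbT.
elim: k => [|k IH] km.
  by rewrite big_ord0 le_min lexx /= /B le_max lexx orbT.
have := IH (ltnW km); rewrite big_ord_recr /= !le_min => /andP[h1 h2].
have [rec|norec] := ltP (run X k w) (psum X k.+1 w); last first.
  by rewrite subrr mul0r addr0 h1 h2.
have [near|_] := boolP (- c <= _); last by rewrite mulr0 addr0 h2 (le_trans h1) // ltW.
have : psum X k.+1 w <= B by rewrite /B le_max; apply/orP; left; lra.
by move=> hB; rewrite mulr1; apply/andP; split; lra.
Qed.

End running_maximum.

Section max_inequality.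
Context (R : realType) d (T : measurableType d) (P : probability T R).
Variable X : nat -> {RV P >-> R}.
Hypothesis Xind : mutually_independent X.

Let mX k : measurable_fun setT (X k : T -> R).
Proof. exact: measurable_funPT. Qed.

(** A maximal inequality of Ottaviani type. An increment of the running maximum depends on the steps
    up to [j], the event that the rest of the walk loses at most [c] on later steps only. Inserting
    this event costs at most a factor 2, and then [sum_record_le] applies. *)
Lemma mean_run_le m (c : R) : 0 <= c ->
  (forall j, (j < m)%N ->
     (2^-1%:E <= P [set w | - c <= psum X m w - psum X j.+1 w]%R)%E) ->
  (mean P (run X m) <= 2%:E * mean P (fun w => Num.max (psum X m w + c) 0)%R)%E.
Proof.
move=> c0 half.
pose D j w := run X j.+1 w - run X j w.
pose B j w := (- c <= psum X m w - psum X j.+1 w).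
have D0 j w : 0 <= D j w by rewrite subr_ge0 /= le_max lexx.
have mD j : measurable_fun setT (D j).
  by apply: measurable_funB; exact: measurable_run.
have mB j : measurable_fun setT (B j).
  by apply: measurable_fun_ler => //; apply: measurable_funB; exact: measurable_psum.
have mB' j : measurable_fun setT (fun w => (B j w)%:R : R).
  exact: measurable_natr_pred.
have runE w : run X m w = \sum_(j < m) D j w.
  rewrite -(big_mkord xpredT (fun j => D j w)) /D telescope_sumr //=.
  by rewrite subr0.
have -> : mean P (run X m) = (\sum_(j < m) mean P (D j))%E.
  by rewrite -mean_sum //; congr mean; apply/funext => w; rewrite runE.
apply: (@le_trans _ _ (2%:E * \sum_(j < m) mean P (fun w => D j w * (B j w)%:R)%R)%E).
  rewrite ge0_sume_distrr; last by move=> j _; apply: mean_ge0 => w; rewrite mulr_ge0.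
  apply: lee_sum => j _.
  pose s := iota 0 j.+1; pose s' := iota j.+1 (m - j.+1).
  pose f (l : seq R) := run (@coord R) j.+1 l - run (@coord R) j l.
  pose g (l : seq R) := (- c <= \sum_(x <- l) x).
  (* The absolute value makes the factor a nonnegative function on the whole line, as the product
     rule requires. *)
  have fD w : D j w = `|f (block X s w)|.
    by rewrite -[LHS]ger0_norm // /f !run_block.
  have gB w : B j w = g (block X s' w).
    by rewrite /g /B (psum_cat X w (ltn_ord j)) addrAC subrr add0r.
  have mf : measurable_seq f.
    by move=> n; apply: measurable_funB; exact: measurable_seq_run.
  have mg : measurable_seq g.
    by move=> n; apply: measurable_fun_ler => //; exact: measurable_seq_sum.
  have us : uniq (s ++ s') by rewrite -iotaD iota_uniq.
  have -> : mean P (fun w => D j w * (B j w)%:R)%R =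
      (mean P (D j) * P [set w | B j w])%E.
    rewrite -mean_pred //.
    have -> : D j = (fun w => `|f (block X s w)|) by apply/funext => w; rewrite fD.
    have -> : B j = (fun w => g (block X s' w)) by apply/funext => w; rewrite gB.
    apply: (@mean_mul_independent _ _ _ _ _ _ _ _ (fun w => f (block X s w))
      (fun w => g (block X s' w)) (fun x => `|x|) (fun b : bool => b%:R)) => //.
    - exact: measurable_block.
    - exact: measurable_block.
    - exact: independent_blocks.
  rewrite muleCA -[leLHS]mule1; apply: lee_wpmul2l; first exact: mean_ge0.
  apply: (@le_trans _ _ (2%:E * 2^-1%:E)%E).
    by rewrite -EFinM divff.
  by apply: lee_wpmul2l => //; exact: half.
apply: lee_wpmul2l => //; rewrite -mean_sum.
- apply: le_mean.
  + by apply: measurable_sum => j; apply: measurable_funM.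
  + apply: measurable_maxr => //; apply: measurable_funD => //; exact: measurable_psum.
  + by move=> w; apply: sumr_ge0 => j _; rewrite mulr_ge0.
  + by move=> w; exact: sum_record_le.
- by move=> j; apply: measurable_funM.
- by move=> j w; rewrite mulr_ge0.
Qed.

End max_inequality.

(** * Persistence events *)

Section persistence_events.
Context (R : realType) d (T : measurableType d) (P : probability T R).
Variable X : nat -> {RV P >-> R}.

Let mX k : measurable_fun setT (X k : T -> R).
Proof. exact: measurable_funPT. Qed.

Lemma max_ipsum_ltP n w (x : R) : (0 < n)%N ->
  reflect (forall k, (1 <= k <= n)%N -> ipsum X k w < x) (max_ipsum X n w < x).
Proof.
move=> n0; apply: (iffP idP) => [h k kn|h].
  apply: le_lt_trans h; apply: (@le_bigmax_seq _ _ _ _ _ k xpredT (fun k => ipsum X k w)) => //.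
  by rewrite mem_index_iota ltnS.
rewrite /max_ipsum big_nat_cond; apply: bigmax_lt; first exact: h.
by move=> k; rewrite ltnS andbT; exact: h.
Qed.

Lemma max_ipsum_leP n w (x : R) : (0 < n)%N ->
  reflect (forall k, (1 <= k <= n)%N -> ipsum X k w <= x) (max_ipsum X n w <= x).
Proof.
move=> n0; apply: (iffP idP) => [h k kn|h].
  apply: le_trans h; apply: (@le_bigmax_seq _ _ _ _ _ k xpredT (fun k => ipsum X k w)) => //.
  by rewrite mem_index_iota ltnS.
rewrite /max_ipsum big_nat_cond; apply: bigmax_le; first exact: h.
by move=> k; rewrite ltnS andbT; exact: h.
Qed.

Let measurable_max_ipsum n : measurable_fun setT (max_ipsum X n).
Proof.
have m1 k : measurable_fun setT (ipsum X k) by exact: measurable_ipsum.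
rewrite /max_ipsum; elim: (index_iota _ _) => [|i r IH].
  by under eq_fun do rewrite big_nil; exact: m1.
by under eq_fun do rewrite big_cons; exact: measurable_maxr.
Qed.

Lemma measurable_max_ipsum_lt n : measurable [set w | max_ipsum X n w < 0].
Proof. by apply: measurable_set_pred; exact: measurable_fun_ltr. Qed.

Lemma measurable_max_ipsum_le n : measurable [set w | max_ipsum X n w <= 0].
Proof. by apply: measurable_set_pred; exact: measurable_fun_ler. Qed.

Lemma wpersistE n :
  (wpersist X n)%:E = P [set w | slope (block X (iota 0 n) w) <= 0].
Proof.
case: n => [|n]; rewrite /wpersist.
  rewrite (_ : [set _ | _] = setT) ?probability_setT //.
  apply/seteqP; split=> // w _ /=; apply/slope_leP => j.
  by rewrite leqn0 => /eqP ->; rewrite /ipsum big_geq // mul0r.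
rewrite fineK; last by rewrite fin_num_measure //; exact: measurable_max_ipsum_le.
congr (P _); apply: eq_set => w; congr is_true; apply/idP/idP.
  move=> /max_ipsum_leP h; apply/slope_leP => j; rewrite size_block size_iota => jn.
  rewrite mul0r ipsum_block //; case: j jn => [|j] jn; first by rewrite /ipsum big_geq.
  exact: h.
move=> /slope_leP; rewrite size_block size_iota => h; apply/max_ipsum_leP => // k /andP[_ kn].
by have := h k kn; rewrite mul0r ipsum_block.
Qed.

(** The first step enters the iterated sum at [k.+1] with weight [k.+1], which is the denominator in
    the slope of the remaining steps. *)
Lemma persistSE n : (persist X n.+1)%:E =
  P [set w | slope (block X (iota 1 n) w) < - X 0%N w].
Proof.
rewrite /persist fineK; last by rewrite fin_num_measure //; exact: measurable_max_ipsum_lt.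
have E w k : (k <= n)%N ->
    ipsum X k.+1 w = X 0%N w * k.+1%:R + ipsum (@coord R) k (block X (iota 1 n) w).
  by move=> kn; rewrite -(@ipsum_block _ _ _ _ _ n.+1) //= ipsum_cons.
congr (P _); apply: eq_set => w; congr is_true; apply/idP/idP.
  move=> /max_ipsum_ltP h; apply/slope_ltP => j; rewrite size_block size_iota => jn.
  have := h isT j.+1; rewrite /= ltnS jn => /(_ isT); rewrite E //; lra.
move=> /slope_ltP; rewrite size_block size_iota => h; apply/max_ipsum_ltP => // -[//|k] /= kn.
by rewrite E //; have := h k kn; lra.
Qed.

Lemma persist_ge0 n : 0 <= persist X n.
Proof. by case: n => // n; rewrite fine_ge0. Qed.

Lemma persist_nonincreasing m n : (m <= n)%N -> persist X n <= persist X m.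
Proof.
have step k : persist X k.+1 <= persist X k.
  case: k => [|k]; rewrite /persist; rewrite -lee_fin fineK ?fin_num_measure //;
    try exact: measurable_max_ipsum_lt.
    by apply: probability_le1; exact: measurable_max_ipsum_lt.
  rewrite fineK ?fin_num_measure //; last exact: measurable_max_ipsum_lt.
  apply: le_measure; rewrite ?inE; try exact: measurable_max_ipsum_lt.
  move=> w /= /max_ipsum_ltP h; apply/max_ipsum_ltP => // i /andP[i0 ik].
  by apply: h => //; rewrite i0 ltnW.
move=> /subnK <-; elim: (n - m)%N => [|k IH]; first by rewrite add0n.
by rewrite addSn; exact: le_trans (step _) IH.
Qed.

Lemma persist_le_wpersist n : persist X n <= wpersist X n.
Proof.
case: n => // n; rewrite /persist /wpersist -lee_fin !fineK ?fin_num_measure //;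
  try exact: measurable_max_ipsum_lt; try exact: measurable_max_ipsum_le.
apply: le_measure; rewrite ?inE; try exact: measurable_max_ipsum_lt;
  try exact: measurable_max_ipsum_le.
by move=> w /=; exact: ltW.
Qed.

End persistence_events.

(** * Centered walks *)

Section centered.
Context (R : realType) d (T : measurableType d) (P : probability T R).
Implicit Types X : nat -> {RV P >-> R}.

Definition centered X :=
  [/\ iid X, (mean P (fun w => `|X 0%N w|)%R < +oo)%E
    & (\int[P]_w (X 0%N w)%:E = 0)%E].

(** The reflected walk: its running maximum is minus the running minimum of the original walk. *)
Definition negX X : nat -> {RV P >-> R} := fun i => [the {mfun T >-> R} of \- X i].

Lemma iid_same_marginals X : iid X -> same_marginals X X.
Proof. by move=> [_ h] i j B mB; exact: h. Qed.

Let measurable_opp (A : set R) : measurable A -> measurable (-%R @^-1` A).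
Proof.
by move=> mA; rewrite -[X in measurable X]setTI; apply: (oppr_measurable measurableT).
Qed.

Lemma iid_negX X : iid X -> iid (negX X).
Proof.
move=> [ind id]; split.
  move=> s A us mA; rewrite (ind s (fun i => -%R @^-1` A i) us) // => i.
  exact: measurable_opp.
by move=> i j A mA; apply: (id i j (-%R @^-1` A)); exact: measurable_opp.
Qed.

Lemma centered_negX X : centered X -> centered (negX X).
Proof.
move=> [Xiid fin X0]; split; first exact: iid_negX.
  by under eq_fun do rewrite /= normrN.
have intX : P.-integrable setT (EFin \o X 0%N).
  by apply/integrableP; split=> //; exact/measurable_EFinP/measurable_funPT.
rewrite /=; under eq_integral do rewrite EFinN.
by rewrite integralN ?X0 ?oppe0 //; exact: integrable_add_def.
Qed.

Lemma psum_negX X n w : psum (negX X) n w = - psum X n w.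
Proof. by rewrite /psum -sumrN. Qed.

Lemma symmetric_marginals X : iid X -> symmetric_rv (X 0%N) ->
  same_marginals X (negX X).
Proof.
move=> [_ id] sym i j B mB; rewrite (id i 0%N) // sym //.
exact: (id 0%N j (-%R @^-1` B) (measurable_opp mB)).
Qed.

End centered.

Section centered_walk.
Context (R : realType) d (T : measurableType d) (P : probability T R).
Variable X : nat -> {RV P >-> R}.
Hypothesis Xc : centered X.

Let mX k : measurable_fun setT (X k : T -> R).
Proof. exact: measurable_funPT. Qed.

Let Xind : mutually_independent X. Proof. by case: Xc => -[]. Qed.
Let XX : same_marginals X X.
Proof. by case: Xc => h _ _; exact: iid_same_marginals. Qed.

Lemma integrable_step k : P.-integrable setT (EFin \o X k).
Proof.
have [_ fin _] := Xc; apply/integrableP; split; first exact/measurable_EFinP.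
apply: le_lt_trans fin; rewrite le_eqVlt; apply/orP; left; apply/eqP.
apply: (mean_block (f := fun l : seq R => `|l`_0|) (s := [:: k]) (s' := [:: 0%N])
  Xind Xind XX) => // n.
by apply: measurableT_comp => //; exact: measurable_coord.
Qed.

Lemma integral_step k : (\int[P]_w (X k w)%:E = 0)%E.
Proof.
have [[_ id] _ X0] := Xc; rewrite -X0.
have E j : (\int[P]_w (X j w)%:E = \int[distribution P (X j)]_x x%:E)%E.
  rewrite integral_distribution //; exact: integrable_step.
by rewrite !E; apply: eq_measure_integral => A mA _; exact: id.
Qed.

Lemma integrable_psum n : P.-integrable setT (EFin \o psum X n).
Proof.
elim: n => [|n IH].
  rewrite (_ : _ \o _ = cst 0%E); first exact: integrable0.
  by apply/funext => w; rewrite /= /psum big_geq.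
rewrite (_ : _ \o _ = (fun w => (psum X n w)%:E + (X n w)%:E)%E).
  by apply: integrableD => //; exact: integrable_step.
by apply/funext => w; rewrite /= psumS.
Qed.

Lemma integral_psum n : (\int[P]_w (psum X n w)%:E = 0)%E.
Proof.
elim: n => [|n IH].
  by rewrite integral0_eq // => w _; rewrite /psum big_geq.
under eq_integral do rewrite psumS EFinD.
rewrite integralD //; [|exact: integrable_psum|exact: integrable_step].
by rewrite IH integral_step adde0.
Qed.

Definition absmean n : R := fine (mean P (fun w => `|psum X n w|)).

Lemma absmeanE n : mean P (fun w => `|psum X n w|) = (absmean n)%:E.
Proof.
rewrite /absmean fineK // ge0_fin_numE; last exact: mean_ge0.
by have /integrableP[_] := integrable_psum n.
Qed.

Lemma absmean_mono m n : (m <= n)%N -> absmean m <= absmean n.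
Proof.
move=> /subnK <-; elim: (n - m)%N => [|k IH]; first by rewrite add0n.
apply: le_trans IH _; rewrite addSn; move: (k + m)%N => {m}{k}m.
rewrite -lee_fin -!absmeanE.
under [leRHS]eq_integral do rewrite psumS.
apply: mean_norm_le_add;
  [exact: measurable_psum | | exact: integrable_step | exact: integral_step].
have := @independent_blocks _ _ _ P X _ _ (fun l => \sum_(x <- l) x) _ _
  (fun l => l`_0) (iota 0 m) [:: m] Xind (@measurable_seq_sum R) (@measurable_coord R 0).
rewrite cats1 -[rcons _ _]/(rcons (iota 0 m) m) => /(_ _).
rewrite rcons_uniq iota_uniq mem_iota add0n ltnn andbF => /(_ isT).
congr (independent_maps _ _); apply/funext => w.
by rewrite -psum_sum_block.
Qed.

Lemma mean_norm_block_sum s : uniq s ->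
  mean P (fun w => `|\sum_(x <- block X s w) x|) = (absmean (size s))%:E.
Proof.
move=> us; rewrite -absmeanE.
under [RHS]eq_integral do rewrite psum_sum_block.
apply: (mean_block (f := fun l : seq R => `|\sum_(x <- l) x|) Xind Xind XX) => //.
- by move=> n; apply: measurableT_comp => //; exact: measurable_seq_sum.
- exact: iota_uniq.
- by rewrite size_iota.
Qed.

End centered_walk.

(** * Mean gaps and the mean range *)

Lemma measurable_seq_gap (R : realType) i : measurable_seq (fun l => @gap R l i).
Proof.
move=> n; rewrite /gap.
apply: measurable_maxr => //; apply: measurable_funB; first apply: measurable_funB.
- by apply: measurableT_comp => //; exact: measurable_coord.
- apply: (measurable_slope (n := minn i n)) => [t|k].
    by rewrite size_rev size_take_min size_tuple.
  have [kl|lk] := ltnP k (minn i n); last first.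
    under eq_fun do rewrite nth_default ?size_rev ?size_take_min ?size_tuple //.
    exact: measurable_cst.
  have E (t : n.-tuple R) : (rev (take i t))`_k = t`_(minn i n - k.+1).
    rewrite nth_rev ?size_take_min ?size_tuple // nth_take //.
    by have := geq_minl i n; lia.
  by under eq_fun do rewrite E; exact: measurable_coord.
- apply: (measurable_slope (n := (n - i.+1)%N)) => [t|k].
    by rewrite size_drop size_tuple.
  by under eq_fun do rewrite nth_drop; exact: measurable_coord.
Qed.

Section gap_mean.
Context (R : realType) d (T : measurableType d) (P : probability T R).
Variable X : nat -> {RV P >-> R}.
Hypothesis Xc : centered X.

Let mX k : measurable_fun setT (X k : T -> R).
Proof. exact: measurable_funPT. Qed.

Let Xind : mutually_independent X. Proof. by case: Xc => -[]. Qed.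
Let XX : same_marginals X X.
Proof. by case: Xc => h _ _; exact: iid_same_marginals. Qed.

(** By reflection the sum of the remaining steps is nonnegative as likely as nonpositive, and one of
    the two always occurs. The form [- 0] fits [mean_range_le] at [c = 0]. *)
Lemma half_le_prob_symmetric m j : symmetric_rv (X 0%N) -> (j < m)%N ->
  (2^-1%:E <= P [set w | - 0 <= psum X m w - psum X j.+1 w]%R)%E.
Proof.
move=> sym jm; have Xiid : iid X by case: Xc.
pose s := iota j.+1 (m - j.+1).
have E w : psum X m w - psum X j.+1 w = \sum_(x <- block X s w) x.
  by rewrite (psum_cat X w jm) addrAC subrr add0r.
have mS : measurable_fun setT (fun w => \sum_(x <- block X s w) x).
  exact: (measurable_block _ _ (@measurable_seq_sum R)).
under eq_set do rewrite oppr0 E.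
have mge : measurable [set w | 0 <= \sum_(x <- block X s w) x].
  by apply: measurable_set_pred; exact: measurable_fun_ler.
have mle : measurable [set w | \sum_(x <- block X s w) x <= 0].
  by apply: measurable_set_pred; exact: measurable_fun_ler.
have opp : P [set w | 0 <= \sum_(x <- block X s w) x] =
    P [set w | \sum_(x <- block X s w) x <= 0].
  rewrite (prob_block (b := fun l : seq R => 0 <= \sum_(x <- l) x)
    (s' := s) Xind (proj1 (iid_negX Xiid)) (symmetric_marginals Xiid sym)) //.
  - congr (P _); apply: eq_set => w; congr is_true.
    by rewrite /block !big_map /= sumrN oppr_ge0.
  - by move=> n; apply: measurable_fun_ler => //; exact: measurable_seq_sum.
  - exact: iota_uniq.
  - exact: iota_uniq.
have : (1 <= P [set w | 0 <= \sum_(x <- block X s w) x]%R +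
            P [set w | \sum_(x <- block X s w) x <= 0]%R)%E.
  rewrite -(probability_setT P); apply: le_trans (measureU2 P mge mle).
  apply: le_measure; rewrite ?inE //; first exact: measurableU.
  by move=> w _ /=; case: (leP 0 (\sum_(x <- block X s w) x)) => h; [left|right; exact: ltW].
rewrite -opp.
have /fineK <- : P [set w | 0 <= \sum_(x <- block X s w) x] \is a fin_num.
  exact: fin_num_measure.
by rewrite -EFinD !lee_fin; lra.
Qed.

(** Markov's inequality: the remaining steps number at most [m], so by monotonicity of [absmean]
    their sum has mean absolute value at most [absmean X m], which is at most half of [c]. *)
Lemma half_le_prob m j c : 0 < c -> 2 * absmean X m <= c -> (j < m)%N ->
  (2^-1%:E <= P [set w | - c <= psum X m w - psum X j.+1 w]%R)%E.
Proof.
move=> c0 mc jm.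
pose s := iota j.+1 (m - j.+1).
have E w : psum X m w - psum X j.+1 w = \sum_(x <- block X s w) x.
  by rewrite (psum_cat X w jm) addrAC subrr add0r.
have mS : measurable_fun setT (fun w => \sum_(x <- block X s w) x).
  exact: (measurable_block _ _ (@measurable_seq_sum R)).
under eq_set do rewrite E.
have mlt : measurable_fun setT (fun w => \sum_(x <- block X s w) x < - c).
  exact: measurable_fun_ltr.
have mge : measurable [set w | - c <= \sum_(x <- block X s w) x].
  by apply: measurable_set_pred; exact: measurable_fun_ler.
have markov : (c%:E * P [set w | \sum_(x <- block X s w) x < - c]%R
    <= (absmean X m)%:E)%E.
  apply: (@le_trans _ _ (absmean X (size s))%:E); last first.
    by rewrite lee_fin absmean_mono // size_iota leq_subr.
  rewrite -mean_norm_block_sum ?iota_uniq // -mean_pred // -meanZ //; last 2 first.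
  - exact: ltW.
  - exact: measurable_natr_pred.
  apply: le_mean => //.
  - by apply: measurable_funM => //; exact: measurable_natr_pred.
  - exact: measurableT_comp.
  - by move=> w; rewrite mulr_ge0 // ltW.
  - move=> w; case: ltP => h /=; last by rewrite mulr0.
    by rewrite mulr1 ltr0_norm; lra.
have -> : [set w | - c <= \sum_(x <- block X s w) x] =
    ~` [set w | \sum_(x <- block X s w) x < - c].
  apply/seteqP; split=> w /=; first by move=> h /(le_lt_trans h); rewrite ltxx.
  by rewrite leNgt => h; apply/negP.
rewrite probability_setC; last exact: measurable_set_pred.
move: markov.
have /fineK <- : P [set w | \sum_(x <- block X s w) x < - c] \is a fin_num.
  by rewrite fin_num_measure //; exact: measurable_set_pred.
rewrite -EFinM -EFinB !lee_fin; nra.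
Qed.

(** The factor 2 of [mean_run_le] meets the pointwise bound [max (s + c) 0 + max (c - s) 0 <= |s| +
    2 c]. *)
Lemma mean_range_le m c : 0 <= c ->
  (forall j, (j < m)%N ->
     (2^-1%:E <= P [set w | - c <= psum X m w - psum X j.+1 w]%R)%E) ->
  (forall j, (j < m)%N ->
     (2^-1%:E <= P [set w | - c <= psum (negX X) m w - psum (negX X) j.+1 w]%R)%E) ->
  (mean P (fun w => run X m w + run (negX X) m w)%R
    <= (2 * absmean X m + 4 * c)%:E)%E.
Proof.
move=> c0 hX hN.
have mN k : measurable_fun setT (negX X k : T -> R) by exact: measurable_funPT.
have mp : measurable_fun setT (psum X m) by exact: measurable_psum.
have mpN : measurable_fun setT (psum (negX X) m) by exact: measurable_psum.
have mM (f : T -> R) : measurable_fun setT f ->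
    measurable_fun setT (fun w => Num.max (f w + c) 0).
  by move=> mf; apply: measurable_maxr => //; exact: measurable_funD.
have M0 (x : R) : 0 <= Num.max x 0 by rewrite le_max lexx orbT.
rewrite meanD; [|exact: measurable_run|exact: measurable_run
  |by move=> w; exact: run_ge0|by move=> w; exact: run_ge0].
have Xiid : iid X by case: Xc.
apply: le_trans (leeD (mean_run_le Xind c0 hX)
  (mean_run_le (proj1 (iid_negX Xiid)) c0 hN)) _.
rewrite -!meanZ //; [|exact: mM..].
rewrite -meanD; first last.
- by move=> w; rewrite mulr_ge0.
- by move=> w; rewrite mulr_ge0.
- by apply: measurable_funM => //; exact: mM.
- by apply: measurable_funM => //; exact: mM.
have -> : (2 * absmean X m + 4 * c)%:E =
    mean P (fun w => 2 * `|psum X m w| + 4 * c).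
  have m1 : measurable_fun setT (fun w => `|psum X m w|) by exact: measurableT_comp.
  have m2 : measurable_fun setT (fun w => 2 * `|psum X m w|).
    exact: measurable_funM.
  rewrite meanD //; last by move=> w; rewrite mulr_ge0.
  by rewrite mean_cst meanZ // absmeanE.
apply: le_mean.
- by apply: measurable_funD; apply: measurable_funM => //; exact: mM.
- by apply: measurable_funD => //; apply: measurable_funM => //; exact: measurableT_comp.
- by move=> w; rewrite addr_ge0 // mulr_ge0.
- move=> w; rewrite psum_negX.
  have [n1 n2] : psum X m w <= `|psum X m w| /\ - psum X m w <= `|psum X m w|.
    by rewrite ler_norm -normrN ler_norm.
  have n0 := normr_ge0 (psum X m w).
  by case: (leP (psum X m w + c) 0) => h1; case: (leP (- psum X m w + c) 0) => h2; lra.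
Qed.

Definition gap_mean n i := mean P (fun w => gap (block X (iota 0 n.+1) w) i).

Let mgap n i : measurable_fun setT (fun w => gap (block X (iota 0 n.+1) w) i).
Proof. exact: (measurable_block _ _ (@measurable_seq_gap R i)). Qed.

Let gap0 (l : seq R) i : 0 <= gap l i.
Proof. by rewrite le_max lexx orbT. Qed.

Lemma absmean_le_sum_gap n :
  ((absmean X n.+1)%:E <= 2%:E * \sum_(i < n.+1) gap_mean n i)%E.
Proof.
rewrite -absmeanE //.
(* For the reflected walk the drop is the final position, and centering makes the mean of its
   positive part half of the mean absolute value. *)
have -> : mean P (fun w => `|psum X n.+1 w|) =
    mean P (fun w => `|psum (negX X) n.+1 w|).
  by congr mean; apply/funext => w; rewrite psum_negX normrN.
rewrite -mean_positive_part; first last.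
- exact: (integral_psum (centered_negX Xc)).
- exact: (integrable_psum (centered_negX Xc)).
apply: lee_wpmul2l => //; rewrite -mean_sum //; apply: le_mean.
- apply: measurable_maxr => //; apply: measurable_psum => k; exact: measurable_funPT.
- exact: measurable_sum.
- by move=> w; rewrite le_max lexx orbT.
- move=> w; rewrite ge_max; apply/andP; split; last exact: sumr_ge0.
  rewrite psum_negX -(psum_block X (n := n.+1)) //.
  by apply: drop_le_sum_gap; rewrite size_block size_iota.
Qed.

Lemma sum_gap_le_range_mean n :
  (\sum_(i < n.+1) gap_mean n i
    <= mean P (fun w => run X n.+1 w + run (negX X) n.+1 w)%R)%E.
Proof.
have mN k : measurable_fun setT (negX X k : T -> R) by exact: measurable_funPT.
rewrite -mean_sum //; apply: le_mean.
- exact: measurable_sum.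
- by apply: measurable_funD; exact: measurable_run.
- by move=> w; exact: sumr_ge0.
- move=> w; apply: sum_gap_le_range; first by rewrite size_block size_iota.
  move=> j jn; rewrite psum_block // psum_le_run // andbT.
  by rewrite lerNl -psum_negX psum_le_run.
Qed.

End gap_mean.

(** * Independence of the three terms of a gap *)

Section split.
Context (R : realType) d (T : measurableType d) (P : probability T R).
Variable X : nat -> {RV P >-> R}.
Hypothesis Xc : centered X.

Let mX k : measurable_fun setT (X k : T -> R).
Proof. exact: measurable_funPT. Qed.

Let Xind : mutually_independent X. Proof. by case: Xc => -[]. Qed.
Let XX : same_marginals X X.
Proof. by case: Xc => h _ _; exact: iid_same_marginals. Qed.

Let mslope s : measurable_fun setT (fun w => slope (block X s w)).
Proof. exact: (measurable_block _ _ (@measurable_seq_slope R)). Qed.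

Lemma prob_slope_le0 s : uniq s ->
  P [set w | slope (block X s w) <= 0] = (wpersist X (size s))%:E.
Proof.
move=> us; rewrite wpersistE.
apply: (prob_block (b := fun l : seq R => slope l <= 0) Xind Xind XX) => //.
- by move=> n; apply: measurable_fun_ler => //; exact: measurable_seq_slope.
- exact: iota_uniq.
- by rewrite size_iota.
Qed.

Lemma prob_slope_lt s j : uniq (j :: s) ->
  P [set w | slope (block X s w) < - X j w] = (persist X (size s).+1)%:E.
Proof.
move=> us; rewrite persistSE.
pose b (l : seq R) := slope (behead l) < - l`_0.
apply: (@prob_block _ _ _ P X X b (j :: s) (iota 0 (size s).+1) Xind Xind XX) => //.
- move=> n; apply: measurable_fun_ltr; last first.
    by apply: measurableT_comp => //; exact: measurable_coord.
  apply: (measurable_slope (n := n.-1)) => [t|k].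
    by rewrite size_behead size_tuple.
  under eq_fun do rewrite nth_behead.
  exact: measurable_coord.
- exact: iota_uniq.
- by rewrite size_iota.
Qed.

Lemma gap_split n i w : (i <= n)%N ->
  gap (block X (iota 0 n.+1) w) i = Num.max (- X i w
    - slope (block X (rev (iota 0 i)) w) - slope (block X (iota i.+1 (n - i)) w)) 0.
Proof.
move=> lin; rewrite /gap block_iota_coord ?ltnS //.
rewrite /block -map_take -map_rev -map_drop take_iota drop_iota.
by rewrite (minn_idPl (leqW lin)) add0n subSS.
Qed.

Lemma uniq_split n i : (i <= n)%N ->
  uniq ((rev (iota 0 i) ++ iota i.+1 (n - i)) ++ [:: i]).
Proof.
move=> lin; rewrite cats1 rcons_uniq cat_uniq rev_uniq !iota_uniq andbT /=.
apply/andP; split; first by rewrite mem_cat mem_rev !mem_iota; lia.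
by apply/hasPn => j; rewrite /= mem_rev !mem_iota; lia.
Qed.

Section pairs.
Variables (s s' : seq nat) (j : nat).
Hypothesis us : uniq ((s ++ s') ++ [:: j]).

Let Z w := (slope (block X s w), slope (block X s' w)).

Let mZ : measurable_fun setT Z.
Proof. exact: measurable_fun_pair. Qed.

Lemma independent_slopes :
  independent_maps P (fun w => slope (block X s w)) (fun w => slope (block X s' w)).
Proof.
apply: independent_blocks => //; try exact: measurable_seq_slope.
by move: us; rewrite cat_uniq => /andP[].
Qed.

Lemma independent_slopes_step : independent_maps P Z (X j : T -> R).
Proof.
(* Independence of blocks concerns functions of a single list each, so both slopes are read off
   [s ++ s'], cut at [size s]. *)
pose f (l : seq R) := (slope (take (size s) l), slope (drop (size s) l)).
have ZE : Z = (fun w => f (block X (s ++ s') w)).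
  apply/funext => w; rewrite /f /block map_cat.
  by rewrite take_size_cat ?drop_size_cat ?size_map.
rewrite ZE; apply: (@independent_blocks _ _ _ P X _ _ f _ _ (fun l => l`_0)
  (s ++ s') [:: j]) => //; last exact: measurable_coord.
move=> n; apply: measurable_fun_pair.
- apply: (measurable_slope (n := minn (size s) n)) => [t|k].
    by rewrite size_take_min size_tuple.
  have [kl|lk] := ltnP k (minn (size s) n); last first.
    under eq_fun do rewrite nth_default ?size_take_min ?size_tuple //.
    exact: measurable_cst.
  have E (t : n.-tuple R) : (take (size s) t)`_k = t`_k.
    by rewrite nth_take // (leq_trans kl) ?geq_minl.
  by under eq_fun do rewrite E; exact: measurable_coord.
- apply: (measurable_slope (n := (n - size s)%N)) => [t|k].
    by rewrite size_drop size_tuple.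
  by under eq_fun do rewrite nth_drop; exact: measurable_coord.
Qed.

(** Slopes are nonnegative; where both are [<= 0] they vanish, and the right-hand integrand is the
    negative part of the step alone, independent of that event. *)
Lemma mean_max_ge :
  (mean P (fun w => Num.max (- X j w) 0)%R
     * ((wpersist X (size s))%:E * (wpersist X (size s'))%:E)
   <= mean P (fun w => Num.max
        (- X j w - slope (block X s w) - slope (block X s' w)) 0)%R)%E.
Proof.
pose g (z : R * R) : R := ((z.1 <= 0) && (z.2 <= 0))%R%:R.
pose f (x : R) : R := Num.max (- x) 0.
have mb : measurable_fun setT (fun z : R * R => (z.1 <= 0) && (z.2 <= 0)).
  by apply: measurable_and; apply: measurable_fun_ler.
have mg : measurable_fun setT g by exact: measurable_natr_pred.
have mf : measurable_fun setT f by exact: measurable_maxr.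
have f0 x : 0 <= f x by rewrite /f le_max lexx orbT.
have g0 z : 0 <= g z by [].
have -> : ((wpersist X (size s))%:E * (wpersist X (size s'))%:E)%E =
    mean P (fun w => g (Z w)).
  have us' : uniq (s ++ s') by move: us; rewrite cat_uniq => /andP[].
  have [us1 us2] : uniq s /\ uniq s' by move: us'; rewrite cat_uniq => /and3P[].
  rewrite mean_pred; last exact: (measurableT_comp mb mZ).
  rewrite -!prob_slope_le0 //.
  have := independent_slopes (measurable_itv `]-oo, 0]) (measurable_itv `]-oo, 0]).
  rewrite /preimage /= => E; rewrite -[LHS]E.
  by congr (P _); apply/seteqP; split=> w /=; rewrite !in_itv /=;
    [move=> [-> ->] | move=> /andP[]].
rewrite muleC -(@mean_mul_independent _ _ _ P _ _ _ _ Z (X j) g f) //; last first.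
  exact: independent_slopes_step.
apply: le_mean.
- by apply: measurable_funM; [exact: measurableT_comp mg mZ | exact: measurableT_comp mf _].
- apply: measurable_maxr => //; apply: measurable_funB => //; apply: measurable_funB => //.
  exact: measurableT_comp.
- by move=> w; rewrite mulr_ge0.
- move=> w; rewrite /g /f /=.
  have := slope_ge0 (block X s w); have := slope_ge0 (block X s' w).
  have [h1|_] := leP (slope (block X s w)) 0; last by rewrite mul0r le_max lexx orbT.
  have [h2|_] := leP (slope (block X s' w)) 0; last by rewrite mul0r le_max lexx orbT.
  by move=> h3 h4; rewrite mul1r (_ : - X j w - _ - _ = - X j w) //; lra.
Qed.

Let G (t : R) : R := lower_tail (X 0%N) t.

Lemma lower_tailE i t : P [set w | t < - X i w] = (G t)%:E.
Proof.
rewrite /G /lower_tail fineK; last first.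
  rewrite fin_num_measure //; apply: measurable_set_pred.
  by apply: measurable_fun_ltr => //; exact: measurableT_comp.
apply: (@prob_block _ _ _ P X X (fun l : seq R => t < - l`_0) [:: i] [:: 0%N]
  Xind Xind XX) => // n.
by apply: measurable_fun_ltr => //; apply: measurableT_comp => //; exact: measurable_coord.
Qed.

Lemma lower_tail_ge0 t : 0 <= G t.
Proof. by rewrite /G /lower_tail fine_ge0. Qed.

Lemma lower_tail_nonincreasing : nonincreasing_fun G.
Proof.
move=> x y xy; rewrite -lee_fin -!(lower_tailE 0%N); apply: le_measure; rewrite ?inE;
  try (apply: measurable_set_pred; apply: measurable_fun_ltr => //; exact: measurableT_comp).
by move=> w /=; exact: le_lt_trans.
Qed.

Lemma measurable_lower_tail : measurable_fun setT G.
Proof. exact: nonincreasing_measurable lower_tail_nonincreasing. Qed.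

(** The step is integrated out with both slopes frozen, which leaves its lower tail. *)
Lemma prob_gap_gt y :
  P [set w | y < - X j w - slope (block X s w) - slope (block X s' w)] =
  mean P (fun w => G (slope (block X s w) + slope (block X s' w) + y)).
Proof.
pose F (z : (R * R) * R) : R := (z.1.1 + z.1.2 + y < - z.2)%R%:R.
have mF' : measurable_fun setT (fun z : (R * R) * R => z.1.1 + z.1.2 + y < - z.2).
  have mN : measurable_fun setT (fun z : (R * R) * R => - z.2).
    exact: (measurableT_comp (@oppr_measurable R setT) measurable_snd).
  apply: measurable_fun_ltr => //.
  have m1 : measurable_fun setT (fun z : (R * R) * R => z.1.1).
    exact: (measurableT_comp measurable_fst measurable_fst).
  have m2 : measurable_fun setT (fun z : (R * R) * R => z.1.2).
    exact: (measurableT_comp measurable_snd measurable_fst).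
  by apply: measurable_funD => //; exact: measurable_funD.
have mF : measurable_fun setT F by exact: measurable_natr_pred.
transitivity (mean P (fun w => F (Z w, X j w))).
  rewrite mean_pred; last first.
    by apply: (measurableT_comp mF'); exact: measurable_fun_pair.
  congr (P _); apply: eq_set => w; congr is_true => /=.
  by apply/idP/idP; lra.
rewrite (mean_independent mZ (mX j) independent_slopes_step mF) //.
apply: eq_integral => w _; rewrite -(lower_tailE j) mean_pred //.
by apply: measurable_fun_ltr => /=; [exact: measurable_cst | exact: measurableT_comp].
Qed.

End pairs.
End split.

(** * Upper bound for the mean gap *)

(** A layer-cake sum of mesh [h]: left endpoints overestimate, because the indicator of [t < w]
    decreases in [t]. The sum stops at [N], and the excess beyond it is kept as a separate term. *)
Lemma positive_part_le_steps (R : realType) (h w : R) N : 0 <= h ->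
  Num.max w 0 <= h * (\sum_(l < N) (l%:R * h < w)%R%:R) + Num.max (w - N%:R * h) 0.
Proof.
move=> h0; elim: N => [|N IH]; first by rewrite big_ord0 mulr0 add0r mul0r subr0.
apply: le_trans IH _; rewrite big_ord_recr /= mulrDr -addrA lerD2l -(natr1 N).
have [lt|ge] := ltP (N%:R * h) w.
  rewrite mulr1 max_l; last by rewrite subr_ge0 ltW.
  by case: (leP (w - (N%:R + 1) * h) 0) => ?; lra.
by rewrite mulr0 add0r max_r ?subr_le0 // le_max lexx orbT.
Qed.

Section tail_sums.
Variables (R : realType) (G e : R -> R) (K L h D : R).
Hypotheses (G0 : forall t, 0 <= G t) (e0 : forall t, 0 <= e t).
Hypotheses (L0 : 0 <= L) (h0 : 0 <= h).
Hypothesis eD : forall t s, 0 <= t -> 0 <= s -> e (t + s) = e t * e s.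
Hypothesis e1 : e h <= 1.
Hypothesis Gdec : forall t s, 0 <= t -> 0 <= s ->
  G (t + s) <= K * G t * G s + L * (e t * e s).
Hypothesis KGh : K * G h <= 2^-1.
Hypothesis sum_e : forall N, \sum_(l < N) e (l%:R * h) <= D.

(** Moving every node by [h] halves the tail up to an error, as [K * G h <= 1/2]. Hence
    [S <= G z + S / 2 + L D (e z)], and the finite sum [S] can be absorbed on the left. *)
Lemma sum_tail_le z N : 0 <= z ->
  \sum_(l < N) G (z + l%:R * h) <= 2 * G z + 2 * L * D * e z.
Proof.
move=> z0; set S := \sum_(l < N) _.
have lh0 l : 0 <= z + l%:R * h by rewrite addr_ge0 // mulr_ge0.
have step l : G (z + l.+1%:R * h) <= 2^-1 * G (z + l%:R * h) + L * (e z * e (l%:R * h)).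
  rewrite -(natr1 l) mulrDl mul1r addrA.
  apply: le_trans (Gdec (lh0 l) h0) _.
  apply: lerD; first by rewrite mulrAC ler_wpM2r.
  rewrite ler_wpM2l // eD // ?mulr_ge0 // -[leRHS]mulr1 ler_wpM2l //.
  exact: mulr_ge0.
have : S <= G z + \sum_(l < N) G (z + l.+1%:R * h).
  have -> : G z + \sum_(l < N) G (z + l.+1%:R * h) =
      \sum_(l < N.+1) G (z + l%:R * h).
    by rewrite big_ord_recl /= mul0r addr0.
  by rewrite big_ord_recr /= -/S lerDl G0.
have : \sum_(l < N) G (z + l.+1%:R * h) <= 2^-1 * S + L * (e z * D).
  apply: le_trans (ler_sum _ (fun (l : 'I_N) _ => step l)) _.
  rewrite big_split /= -!mulr_sumr lerD2l.
  by rewrite ler_wpM2l // ler_wpM2l // sum_e.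
by move=> h1 h2; lra.
Qed.

(** The decay inequality first detaches [v] from [u + l h], and only then is the sum over [l] taken.
    This is why [e u * G v] appears without its mirror image. *)
Lemma sum_tail_add_le u v N : 0 <= u -> 0 <= v -> 0 <= K -> 
  \sum_(l < N) G (u + v + l%:R * h) <=
  2 * K * (G u * G v) + 2 * K * L * D * (e u * G v) + L * D * (e u * e v).
Proof.
move=> u0 v0 K0.
have step l : G (u + v + l%:R * h) <=
    K * G v * G (u + l%:R * h) + L * (e v * e u * e (l%:R * h)).
  rewrite (_ : u + v + l%:R * h = v + (u + l%:R * h)); last by ring.
  have lh0 : 0 <= l%:R * h by rewrite mulr_ge0.
  apply: le_trans (Gdec v0 (addr_ge0 u0 lh0)) _.
  by rewrite eD // -(mulrA (e v)).
apply: le_trans (ler_sum _ (fun (l : 'I_N) _ => step l)) _.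
rewrite big_split /= -!mulr_sumr.
have KG0 : 0 <= K * G v by rewrite mulr_ge0.
have h1 := ler_wpM2l KG0 (sum_tail_le N u0).
have ee0 : 0 <= L * (e v * e u) by rewrite !mulr_ge0.
have h2 := ler_wpM2l ee0 (sum_e N).
apply: le_trans (lerD h1 _) _; first by rewrite mulrA; exact: h2.
by rewrite le_eqVlt; apply/orP; left; apply/eqP; ring.
Qed.

End tail_sums.

Section upper.
Context (R : realType) d (T : measurableType d) (P : probability T R).
Variable X : nat -> {RV P >-> R}.
Hypothesis Xc : centered X.

Let mX k : measurable_fun setT (X k : T -> R).
Proof. exact: measurable_funPT. Qed.

Let Xind : mutually_independent X. Proof. by case: Xc => -[]. Qed.
Let XX : same_marginals X X.
Proof. by case: Xc => h _ _; exact: iid_same_marginals. Qed.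

Let mslope s : measurable_fun setT (fun w => slope (block X s w)).
Proof. exact: (measurable_block _ _ (@measurable_seq_slope R)). Qed.

Let G (t : R) : R := lower_tail (X 0%N) t.

Let mG : measurable_fun setT G.
Proof. exact: measurable_lower_tail. Qed.

(** Attaching a fresh independent step, with an index above all of [s], turns the mean of the tail
    into the probability that the slope is below minus that step. *)
Lemma mean_lower_tail_slope s : uniq s ->
  mean P (fun w => G (slope (block X s w))) = (persist X (size s).+1)%:E.
Proof.
move=> us; pose j := (\max_(i <- s) i).+1.
have js : j \notin s.
  apply/negP => js; have := @leq_bigmax_seq _ s xpredT id j js isT.
  by rewrite ltnn.
have ujs : uniq (j :: s) by rewrite /= js.
have ujs' : uniq ((s ++ [::]) ++ [:: j]) by rewrite cats0 cats1 rcons_uniq js.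
have s0 : slope [::] = 0 :> R.
  apply/eqP; rewrite eq_le slope_ge0 andbT; apply/slope_leP => k.
  by rewrite leqn0 => /eqP ->; rewrite /ipsum big_geq // mul0r.
rewrite -(prob_slope_lt Xc ujs).
transitivity (mean P (fun w => G (slope (block X s w) + slope (block X [::] w) + 0))).
  by congr mean; apply/funext => w; rewrite /= s0 !addr0.
rewrite -(prob_gap_gt Xc ujs'); congr (P _); apply: eq_set => w; congr is_true.
by rewrite /= s0; apply/idP/idP; lra.
Qed.

Lemma mean_excess_cvg0 (h : R) i : 0 < h ->
  (mean P (fun w => Num.max (- X i w - N%:R * h) 0)%R @[N --> \oo] --> 0)%E.
Proof.
move=> h0.
have mN N : measurable_fun setT (fun w => (Num.max (- X i w - N%:R * h) 0)%:E).
  apply/measurable_EFinP; apply: measurable_maxr => //.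
  by apply: measurable_funB => //; exact: measurableT_comp.
have [||||_ _] := @dominated_convergence _ _ _ P setT measurableT
  (fun N w => (Num.max (- X i w - N%:R * h) 0)%:E) (cst 0%E)
  (fun w => (`|X i w|)%:E) mN.
- exact: measurable_cst.
- apply: aeW => w _ /=; apply: cvg_near_cst.
  near=> N; rewrite max_r // subr_le0.
  rewrite -ler_pdivrMr //; near: N; exact: nbhs_infty_ger.
- exact/integrable_norm/integrable_step.
- apply: aeW => w N _; rewrite lee_fin ger0_norm ?le_max ?lexx ?orbT //.
  rewrite ge_max normr_ge0 andbT -normrN.
  have Nh : 0 <= N%:R * h by rewrite mulr_ge0 // ltW.
  by have := ler_norm (- X i w); lra.
- by rewrite integral0.
Unshelve. all: by end_near. Qed.

Lemma gap_mean_le_excess n i N (h B : R) : (i <= n)%N -> 0 <= h -> 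
  (mean P (fun w => h * \sum_(l < N) G (slope (block X (rev (iota 0 i)) w) +
      slope (block X (iota i.+1 (n - i)) w) + l%:R * h))%R <= B%:E ->
  gap_mean X n i <= B%:E + mean P (fun w => Num.max (- X i w - N%:R * h) 0)%R)%E.
Proof.
move=> lin h0; set s := rev _; set s' := iota i.+1 _ => hB.
pose Y w := - X i w - slope (block X s w) - slope (block X s' w).
have mY : measurable_fun setT Y.
  apply: measurable_funB => //; apply: measurable_funB => //; exact: measurableT_comp.
have mb l : measurable_fun setT (fun w => l%:R * h < Y w) by exact: measurable_fun_ltr.
have mb' l : measurable_fun setT (fun w => (l%:R * h < Y w)%R%:R : R).
  exact: measurable_natr_pred.
have msum : measurable_fun setT (fun w => h * \sum_(l < N) (l%:R * h < Y w)%R%:R).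
  by apply: measurable_funM => //; exact: measurable_sum.
have mE : measurable_fun setT (fun w => Num.max (- X i w - N%:R * h) 0).
  apply: measurable_maxr => //; apply: measurable_funB => //; exact: measurableT_comp.
have s0 w : 0 <= h * \sum_(l < N) (l%:R * h < Y w)%R%:R.
  by rewrite mulr_ge0 // sumr_ge0.
have E0 w : 0 <= Num.max (- X i w - N%:R * h) 0 by rewrite le_max lexx orbT.
apply: (@le_trans _ _ (mean P (fun w => h * \sum_(l < N) (l%:R * h < Y w)%R%:R
    + Num.max (- X i w - N%:R * h) 0)%R)).
  apply: le_mean.
  - exact: (measurable_block _ _ (@measurable_seq_gap R i)).
  - exact: measurable_funD.
  - by move=> w; rewrite le_max lexx orbT.
  - move=> w; rewrite gap_split // -/s -/s' -/(Y w).
    apply: le_trans (positive_part_le_steps (Y w) N h0) _; rewrite lerD2l.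
    rewrite ge_max !le_max lexx orbT andbT; apply/orP; left.
    by rewrite /Y; have := slope_ge0 (block X s w); have := slope_ge0 (block X s' w); lra.
rewrite meanD // leeD2r //; apply: le_trans hB.
rewrite le_eqVlt; apply/orP; left; apply/eqP.
have mGl l : measurable_fun setT
    (fun w => G (slope (block X s w) + slope (block X s' w) + l%:R * h)).
  apply: measurableT_comp => //.
  by apply: measurable_funD => //; exact: measurable_funD.
have mGs : measurable_fun setT
    (fun w => \sum_(l < N) G (slope (block X s w) + slope (block X s' w) + l%:R * h)).
  exact: measurable_sum.
have Gl0 l w : 0 <= G (slope (block X s w) + slope (block X s' w) + l%:R * h).
  exact: lower_tail_ge0.
have Gs0 w : 0 <= \sum_(l < N) G (slope (block X s w) + slope (block X s' w) + l%:R * h).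
  exact: sumr_ge0.
have mbs : measurable_fun setT (fun w => \sum_(l < N) (l%:R * h < Y w)%R%:R : R).
  exact: measurable_sum.
have bs0 w : 0 <= \sum_(l < N) (l%:R * h < Y w)%R%:R :> R by exact: sumr_ge0.
rewrite (meanZ P h0 mbs bs0) (meanZ P h0 mGs Gs0); congr (_ * _)%E.
rewrite !mean_sum //; apply: eq_bigr => l _; rewrite mean_pred //.
by apply: (prob_gap_gt Xc); exact: uniq_split.
Qed.

End upper.

Section upper_bound.
Context (R : realType) d (T : measurableType d) (P : probability T R).
Variable X : nat -> {RV P >-> R}.
Hypothesis Xc : centered X.

Let Xind : mutually_independent X. Proof. by case: Xc => -[]. Qed.
Let XX : same_marginals X X.
Proof. by case: Xc => h _ _; exact: iid_same_marginals. Qed.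

Let mslope s : measurable_fun setT (fun w => slope (block X s w)).
Proof. exact: (measurable_block _ _ (@measurable_seq_slope R)). Qed.

Let G (t : R) : R := lower_tail (X 0%N) t.

Let mG : measurable_fun setT G.
Proof. exact: measurable_lower_tail. Qed.

Let G0 t : 0 <= G t.
Proof. exact: lower_tail_ge0. Qed.

Variables (e : R -> R) (K L h D C : R).
Hypotheses (K0 : 0 <= K) (L0 : 0 <= L) (h0 : 0 < h) (D0 : 0 <= D) (C0 : 0 <= C).
Hypotheses (me : measurable_fun setT e) (e0 : forall t, 0 <= e t).
Hypothesis eD : forall t s, 0 <= t -> 0 <= s -> e (t + s) = e t * e s.
Hypothesis e1 : e h <= 1.
Hypothesis Gdec : forall t s, 0 <= t -> 0 <= s ->
  G (t + s) <= K * G t * G s + L * (e t * e s).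
Hypothesis KGh : K * G h <= 2^-1.
Hypothesis sum_e : forall N, \sum_(l < N) e (l%:R * h) <= D.
Hypothesis mean_e : forall n,
  (mean P (fun w => e (slope (block X (iota 0 n) w))) <= (C * persist X n)%:E)%E.

Let mean_e_block s : uniq s ->
  (mean P (fun w => e (slope (block X s w))) <= (C * persist X (size s))%:E)%E.
Proof.
move=> us; rewrite (@mean_block _ _ _ P X X (fun l => e (slope l)) s (iota 0 (size s)))
  ?size_iota ?iota_uniq //.
by move=> n; apply: (measurableT_comp me); exact: measurable_seq_slope.
Qed.

Let mean_G_block s : uniq s ->
  (mean P (fun w => G (slope (block X s w))) <= (persist X (size s))%:E)%E.
Proof.
by move=> us; rewrite mean_lower_tail_slope // lee_fin persist_nonincreasing.
Qed.

(** By independence each product in [sum_tail_add_le] has the product of the means as its mean,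
    which gives a bound [B] not depending on [N]. The mesh [h] stays fixed and only the truncation
    [N] tends to infinity, which removes the excess. *)
Lemma gap_mean_le_persist n i : (i <= n)%N ->
  (gap_mean X n i <= (h * (2 * K + 2 * K * L * D * C + L * D * C ^+ 2)
     * (persist X i * persist X (n - i)))%:E)%E.
Proof.
move=> lin.
set s := rev (iota 0 i); set s' := iota i.+1 (n - i).
have [us us'] : uniq s /\ uniq s' by rewrite rev_uniq !iota_uniq.
have [ss ss'] : size s = i /\ size s' = (n - i)%N by rewrite size_rev !size_iota.
pose U w := slope (block X s w); pose V w := slope (block X s' w).
have UV : independent_maps P U V := independent_slopes Xc (uniq_split lin).
have mU : measurable_fun setT U by exact: mslope.
have mV : measurable_fun setT V by exact: mslope.
set pi := persist X i; set pn := persist X (n - i).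
have [pi0 pn0] : 0 <= pi /\ 0 <= pn by rewrite !persist_ge0.
have prod (f g : R -> R) (a b : R) : measurable_fun setT f -> measurable_fun setT g ->
    (forall x, 0 <= f x) -> (forall x, 0 <= g x) -> 0 <= a -> 0 <= b ->
    (mean P (fun w => f (U w)) <= a%:E)%E -> (mean P (fun w => g (V w)) <= b%:E)%E ->
    (mean P (fun w => f (U w) * g (V w))%R <= (a * b)%:E)%E.
  move=> mf mg f0 g0 a0 b0 fa gb; rewrite mean_mul_independent // EFinM.
  by apply: lee_pmul => //; exact: mean_ge0.
have GU : (mean P (fun w => G (U w)) <= pi%:E)%E by rewrite /pi -ss; exact: mean_G_block.
have GV : (mean P (fun w => G (V w)) <= pn%:E)%E by rewrite /pn -ss'; exact: mean_G_block.
have eU : (mean P (fun w => e (U w)) <= (C * pi)%:E)%E by rewrite /pi -ss; exact: mean_e_block.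
have eV : (mean P (fun w => e (V w)) <= (C * pn)%:E)%E by rewrite /pn -ss'; exact: mean_e_block.
have Cpi : 0 <= C * pi by rewrite mulr_ge0.
have Cpn : 0 <= C * pn by rewrite mulr_ge0.
have b1 := prod _ _ _ _ mG mG G0 G0 pi0 pn0 GU GV.
have b2 := prod _ _ _ _ me mG e0 G0 Cpi pn0 eU GV.
have b3 := prod _ _ _ _ me me e0 e0 Cpi Cpn eU eV.
set B := h * _ * _.
have key N : (gap_mean X n i <=
    B%:E + mean P (fun w => Num.max (- X i w - N%:R * h) 0)%R)%E.
  apply: gap_mean_le_excess => //; first exact: ltW.
  rewrite -/s -/s'.
  pose F w := 2 * K * (G (U w) * G (V w)) + 2 * K * L * D * (e (U w) * G (V w))
    + L * D * (e (U w) * e (V w)).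
  have mc (f : R -> R) (W : T -> R) : measurable_fun setT f -> measurable_fun setT W ->
      measurable_fun setT (fun w => f (W w)).
    by move=> mf mW; exact: (measurableT_comp mf mW).
  have m1 : measurable_fun setT (fun w => G (U w) * G (V w)).
    by apply: measurable_funM; exact: mc.
  have m2 : measurable_fun setT (fun w => e (U w) * G (V w)).
    by apply: measurable_funM; exact: mc.
  have m3 : measurable_fun setT (fun w => e (U w) * e (V w)).
    by apply: measurable_funM; exact: mc.
  have c1 : 0 <= 2 * K by rewrite mulr_ge0.
  have c2 : 0 <= 2 * K * L * D by rewrite !mulr_ge0.
  have c3 : 0 <= L * D by rewrite mulr_ge0.
  have n1 w : 0 <= G (U w) * G (V w) by rewrite mulr_ge0.
  have n2 w : 0 <= e (U w) * G (V w) by rewrite mulr_ge0.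
  have n3 w : 0 <= e (U w) * e (V w) by rewrite mulr_ge0.
  have M c (f : T -> R) : measurable_fun setT f -> measurable_fun setT (fun w => c * f w).
    by move=> mf; exact: measurable_funM.
  have mF : measurable_fun setT F.
    by apply: measurable_funD; [apply: measurable_funD|]; exact: M.
  have F0 w : 0 <= F w by rewrite !addr_ge0 // mulr_ge0.
  apply: (@le_trans _ _ (mean P (fun w => h * F w))).
    apply: le_mean.
    - apply: M; apply: measurable_sum => l; apply: (mc G) => //.
      by apply: measurable_funD => //; exact: measurable_funD.
    - exact: M.
    - by move=> w; rewrite mulr_ge0 ?sumr_ge0 // ltW.
    - move=> w; rewrite ler_pM2l //.
      by apply: (sum_tail_add_le G0 e0 L0 (ltW h0) eD e1 Gdec KGh sum_e) => //;
        exact: slope_ge0.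
  rewrite meanZ ?(ltW h0) // /F.
  rewrite (meanD P (measurable_funD (M _ _ m1) (M _ _ m2)) (M _ _ m3)); first last.
  - by move=> w; rewrite mulr_ge0.
  - by move=> w; rewrite addr_ge0 // mulr_ge0.
  rewrite (meanD P (M _ _ m1) (M _ _ m2)); first last.
  - by move=> w; rewrite mulr_ge0.
  - by move=> w; rewrite mulr_ge0.
  rewrite (meanZ P c1 m1 n1) (meanZ P c2 m2 n2) (meanZ P c3 m3 n3).
  have -> : B%:E = (h%:E * ((2 * K)%:E * (pi * pn)%:E
      + (2 * K * L * D)%:E * (C * pi * pn)%:E + (L * D)%:E * (C * pi * (C * pn))%:E))%E.
    by rewrite -!(EFinM, EFinD); congr EFin; rewrite /B; ring.
  apply: lee_wpmul2l; first by rewrite lee_fin ltW.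
  by apply: leeD; [apply: leeD|]; apply: lee_wpmul2l.
have cvgB : (B%:E + mean P (fun w => Num.max (- X i w - N%:R * h) 0)%R
    @[N --> \oo] --> B%:E)%E.
  rewrite -[X in _ --> X]adde0; apply: cvgeD => //; last exact: mean_excess_cvg0.
  exact: cvg_cst.
rewrite -(cvg_lim _ cvgB) //; apply: lime_ge; first by apply/cvg_ex; exists B%:E.
by apply: nearW => N; exact: key.
Qed.

End upper_bound.

(** The bound uses a larger ratio [y], so that the constant can be kept free of the mesh, which
    depends on [E|X_1|]. *)
Lemma sum_geometric_le (R : realType) (x y : R) N : 0 <= x -> x <= y -> y < 1 ->
  \sum_(l < N) x ^+ l <= (1 - y)^-1.
Proof.
move=> x0 xy y1; have y1' : 0 < 1 - y by rewrite subr_gt0.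
rewrite -[leRHS]mul1r ler_pdivlMr //.
apply: (@le_trans _ _ ((\sum_(l < N) x ^+ l) * (1 - x))).
  by rewrite ler_wpM2l ?sumr_ge0 // => [l _|]; [exact: exprn_ge0 | lra].
have -> : (\sum_(l < N) x ^+ l) * (1 - x) = 1 - x ^+ N.
  by have := subrX1 x N; set S := \sum_(_ < _) _; lra.
by rewrite lerBlDr lerDl exprn_ge0.
Qed.

(** * Exponential weights of the slope *)

Section slope_tail.
Context (R : realType) d (T : measurableType d) (P : probability T R).
Variable X : nat -> {RV P >-> R}.
Hypothesis Xc : centered X.

Let mX k : measurable_fun setT (X k : T -> R).
Proof. exact: measurable_funPT. Qed.

Let Xind : mutually_independent X. Proof. by case: Xc => -[]. Qed.
Let XX : same_marginals X X.
Proof. by case: Xc => h _ _; exact: iid_same_marginals. Qed.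

Let mslope s : measurable_fun setT (fun w => slope (block X s w)).
Proof. exact: (measurable_block _ _ (@measurable_seq_slope R)). Qed.

Let G (t : R) : R := lower_tail (X 0%N) t.

Let F n (y : R) : R := fine (P [set w | slope (block X (iota 0 n) w) <= y]).

Let mle s y : measurable [set w | slope (block X s w) <= y].
Proof. by apply: measurable_set_pred; exact: measurable_fun_ler. Qed.

Let mlt j t : measurable [set w | t < - X j w].
Proof.
by apply: measurable_set_pred; apply: measurable_fun_ltr => //; exact: measurableT_comp.
Qed.

Let FE s y : uniq s -> P [set w | slope (block X s w) <= y] = (F (size s) y)%:E.
Proof.
move=> us; rewrite /F fineK ?fin_num_measure //.
apply: (@prob_block _ _ _ P X X (fun l => slope l <= y) s (iota 0 (size s)) Xind Xind XX) => //.
- by move=> n; apply: measurable_fun_ler => //; exact: measurable_seq_slope.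
- exact: iota_uniq.
- by rewrite size_iota.
Qed.

Let prob_step_slope j s t y : uniq (j :: s) ->
  P ([set w | t < - X j w] `&` [set w | slope (block X s w) <= y]) =
  (G t * F (size s) y)%:E.
Proof.
move=> ujs; have us : uniq s by case/andP: ujs.
have := @independent_blocks _ _ _ P X _ _ (fun l => t < - l`_0) _ _
  (fun l => slope l <= y) [:: j] s Xind _ _ ujs.
move=> /(_ _ _ [set true] [set true] _ _) E.
rewrite EFinM -(lower_tailE Xc j) -FE //; apply: E => //.
- by move=> n; apply: measurable_fun_ltr => //; apply: measurableT_comp => //; exact: measurable_coord.
- by move=> n; apply: measurable_fun_ler => //; exact: measurable_seq_slope.
Qed.

(** The walk is first extended by the step [n], which can only raise the slope. Behind the step [0],
    below [- r], there are then again [n] steps, so the same [F n] stands on both sides. *)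
Let step r n l : 0 < r -> G r * F n (l.+1%:R * r) <= F n (l%:R * r).
Proof.
move=> r0.
have u : uniq (0%N :: iota 1 n) by exact: (iota_uniq 0 n.+1).
have := prob_step_slope r (l.+1%:R * r) u; rewrite size_iota => E.
have FEn := FE (l%:R * r) (iota_uniq 0 n); rewrite size_iota in FEn.
rewrite -lee_fin -E -FEn.
apply: le_measure; rewrite ?inE //; first exact: measurableI.
move=> w /= [lt le].
apply: le_trans (slope_cat_ge _ (block X [:: n] w)) _.
have -> : block X (iota 0 n) w ++ block X [:: n] w = X 0%N w :: block X (iota 1 n) w.
  by rewrite /block -map_cat -[_ ++ _]/(iota 0 n ++ iota (0 + n) 1) -iotaD addn1.
apply: le_trans (slope_cons_le _ _) _.
have : slope (block X (iota 1 n) w) <= l.+1%:R * r := le.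
rewrite ge_max mulr_ge0 ?(ltW r0) // -(natr1 l).
by set z := slope _; have : r < - X 0%N w := lt; lra.
Qed.

(* A step below [- r] in front of the walk lowers the slope by at least [r], until
   persistence holds. *)
Lemma slope_tail_le r n l : 0 < r ->
  G r ^+ l.+1 * fine (P [set w | slope (block X (iota 0 n) w) <= l.+1%:R * r])
    <= persist X n.
Proof.
move=> r0; have G0 : 0 <= G r by exact: lower_tail_ge0.
rewrite -/(F n _); elim: l => [|l IH]; last first.
  apply: le_trans IH; rewrite exprSr -mulrA ler_wpM2l ?exprn_ge0 //.
  exact: step.
rewrite expr1 mul1r.
have u : uniq (0%N :: iota 1 n) by exact: (iota_uniq 0 n.+1).
have := prob_step_slope r r u; rewrite size_iota => E.
apply: (@le_trans _ _ (persist X n.+1)); last by rewrite persist_nonincreasing.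
rewrite -lee_fin -E persistSE; apply: le_measure; rewrite ?inE //.
- exact: measurableI.
- apply: measurable_set_pred; apply: measurable_fun_ltr => //; exact: measurableT_comp.
- by move=> w /= [lt le]; exact: le_lt_trans lt.
Qed.

(** Cut the values of the slope into layers of width [r]. Layer [l] has weight at most [e r ^+ l],
    and by [slope_tail_le] probability at most [persist X n / G r ^+ l.+1]; the series has ratio
    [e r / G r < 1]. *)
Lemma mean_geometric_slope_le (e : R -> R) r n : 0 < r -> 0 < G r -> 
  measurable_fun setT e -> (forall t, 0 <= e t) ->
  (forall t s, 0 <= t -> t <= s -> e s <= e t) ->
  (forall l : nat, e (l%:R * r) = e r ^+ l) -> e r < G r -> G r <= 1 ->
  (mean P (fun w => e (slope (block X (iota 0 n) w)))
    <= ((G r)^-1 / (1 - e r / G r) * persist X n)%:E)%E.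
Proof.
move=> r0 q0 me e0 edec epow eq q1.
set q := G r; set rho := e r; set p := persist X n.
pose Z w := slope (block X (iota 0 n) w).
have mZ : measurable_fun setT Z by exact: mslope.
have mZle y : measurable_fun setT (fun w => Z w <= y).
  by apply: measurable_fun_ler => //; exact: measurable_cst.
have x1 : rho / q < 1 by rewrite ltr_pdivrMr // mul1r.
have x0 : 0 <= rho / q by rewrite (divr_ge0 (e0 r) (ltW q0)).
have mind l : measurable_fun setT (fun w => (Z w <= l.+1%:R * r)%R%:R : R).
  exact: measurable_natr_pred.
(* The first layer containing [Z w] already pays for [e (Z w)]; [rho ^+ N] covers the values beyond
   all [N] layers. *)
have pathwise N w : e (Z w) <= \sum_(l < N) rho ^+ l * (Z w <= l.+1%:R * r)%R%:R + rho ^+ N.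
  have Z0 : 0 <= Z w by exact: slope_ge0.
  have term0 l : 0 <= rho ^+ l * (Z w <= l.+1%:R * r)%R%:R :> R.
    by rewrite mulr_ge0 // exprn_ge0 // e0.
  elim: N => [|N IH].
    by rewrite big_ord0 add0r expr0 -(expr0 rho) -epow mul0r edec.
  rewrite big_ord_recr /=.
  have [le|gt] := leP (Z w) (N.+1%:R * r).
    by rewrite mulr1; apply: le_trans IH _; rewrite lerDl exprn_ge0 // e0.
  rewrite mulr0 addr0; apply: (@le_trans _ _ (rho ^+ N.+1)).
    by rewrite -epow; apply: edec; [rewrite mulr_ge0 // ltW | exact: ltW].
  by rewrite lerDr sumr_ge0.
have bound N : (mean P (fun w => e (Z w)) <= (q^-1 / (1 - rho / q) * p + rho ^+ N)%:E)%E.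
  have m1 l : measurable_fun setT (fun w => rho ^+ l * (Z w <= l.+1%:R * r)%R%:R).
    exact: measurable_funM.
  have p1 l w : 0 <= rho ^+ l * (Z w <= l.+1%:R * r)%R%:R :> R.
    by rewrite mulr_ge0 // exprn_ge0 // e0.
  have rho0 k : 0 <= rho ^+ k by rewrite exprn_ge0 // e0.
  apply: (@le_trans _ _ (mean P (fun w =>
      \sum_(l < N) rho ^+ l * (Z w <= l.+1%:R * r)%R%:R + rho ^+ N))).
    apply: le_mean => //; first exact: (measurableT_comp me mZ).
    by apply: measurable_funD => //; exact: measurable_sum.
  rewrite meanD //; first last.
  - by move=> w; exact: sumr_ge0.
  - exact: measurable_sum.
  rewrite mean_cst EFinD leeD2r // mean_sum //.
  apply: (@le_trans _ _ (\sum_(l < N) (q^-1 * p * (rho / q) ^+ l)%:E)%E).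
    apply: lee_sum => l _; rewrite meanZ // mean_pred //.
    have := slope_tail_le n l r0; rewrite -/q -/p -[P _]fineK ?fin_num_measure //.
    rewrite -EFinM lee_fin => h.
    rewrite (_ : q^-1 * p * (rho / q) ^+ l = rho ^+ l * (p / q ^+ l.+1)).
      by rewrite ler_wpM2l // ler_pdivlMr ?exprn_gt0 // mulrC.
    by rewrite expr_div_n exprS invfM; ring.
  rewrite sumEFin lee_fin -mulr_sumr.
  rewrite mulrAC ler_wpM2r ?persist_ge0 //.
  rewrite ler_wpM2l ?invr_ge0 ?(ltW q0) //.
  exact: sum_geometric_le.
have cv : q^-1 / (1 - rho / q) * p + rho ^+ N @[N --> \oo] --> q^-1 / (1 - rho / q) * p.
  rewrite -[X in _ --> X]addr0; apply: cvgD; first exact: cvg_cst.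
  by apply: cvg_expr; rewrite ger0_norm ?(e0 r) // (lt_le_trans eq).
have fin : mean P (fun w => e (Z w)) \is a fin_num.
  apply: (@mean_bounded_fin _ _ _ _ _ (e 0)); first exact: (measurableT_comp me mZ).
  by move=> w; rewrite e0 edec // slope_ge0.
rewrite -(fineK fin) lee_fin -(cvg_lim _ cv) //; apply: limr_ge.
  by apply/cvg_ex; eexists; exact: cv.
by apply: nearW => N; rewrite -lee_fin fineK.
Qed.

End slope_tail.

(** The decay assumption is stated for positive arguments only, whereas slopes and the first node of
    the Riemann sum may be 0. Right continuity of the tail closes this gap. *)
Lemma lower_tail_right_le (R : realType) d (T : measurableType d)
    (P : probability T R) (X : nat -> {RV P >-> R}) (y B : R) : centered X ->
  (forall eps, 0 < eps -> lower_tail (X 0%N) (y + eps) <= B) ->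
  lower_tail (X 0%N) y <= B.
Proof.
move=> Xc h.
have E t : ccdf (negX X 0) t = (lower_tail (X 0%N) t)%:E.
  rewrite -(lower_tailE Xc 0) /ccdf /distribution /pushforward; congr (P _).
  by apply/seteqP; split=> w /=; rewrite in_itv /= andbT.
have cv := @ccdf_right_continuous _ _ _ _ (negX X 0) y.
rewrite -lee_fin -E -(cvg_lim _ cv) //; apply: lime_le.
  by apply/cvg_ex; eexists; exact: cv.
near=> t; rewrite E lee_fin -[t](subrKC y); apply: h.
by rewrite subr_gt0; near: t; exact: nbhs_right_gt.
Unshelve. all: by end_near. Qed.

(** * Lower bound for the convolution *)

Section lower_bound.
Context (R : realType) d (T : measurableType d) (P : probability T R).
Variable X : nat -> {RV P >-> R}.
Hypothesis Xc : centered X.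
Hypothesis X1 : 0 < absmean X 1.

Let mX k : measurable_fun setT (X k : T -> R).
Proof. exact: measurable_funPT. Qed.

Let G (t : R) : R := lower_tail (X 0%N) t.

Lemma mean_norm_step i : mean P (fun w => `|X i w|) = (absmean X 1)%:E.
Proof.
rewrite -(@mean_norm_block_sum _ _ _ _ _ Xc [:: i]) //.
by congr mean; apply/funext => w; rewrite /= big_seq1.
Qed.

Lemma mean_negative_part i :
  mean P (fun w => Num.max (- X i w) 0) = (2^-1 * absmean X 1)%:E.
Proof.
have := mean_positive_part (integrable_step (centered_negX Xc) i)
  (integral_step (centered_negX Xc) i).
have -> : mean P (fun w => `|negX X i w|) = (absmean X 1)%:E.
  by rewrite -(mean_norm_step i); congr mean; apply/funext => w; rewrite /= normrN.
by move=> E; rewrite EFinM -E muleA -EFinM mulVf // mul1e.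
Qed.

Lemma markov_lower_tail t : 0 <= t -> t * G t <= 2^-1 * absmean X 1.
Proof.
move=> t0; rewrite -lee_fin -(mean_negative_part 0) EFinM -(lower_tailE Xc 0).
have mb : measurable_fun setT (fun w => t < - X 0%N w).
  by apply: measurable_fun_ltr => //; exact: measurableT_comp.
rewrite -mean_pred // -meanZ //; last exact: measurable_natr_pred.
apply: le_mean.
- by apply: measurable_funM => //; exact: measurable_natr_pred.
- by apply: measurable_maxr => //; exact: measurableT_comp.
- by move=> w; rewrite mulr_ge0.
- move=> w; have [lt|_] /= := ltP t (- X 0%N w); last by rewrite mulr0 le_max lexx orbT.
  by rewrite mulr1 le_max ltW.
Qed.

(** Otherwise the step is almost surely below [- r], its positive part has mean 0, and centering
    forces [E|X_1| = 0]. *)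
Lemma lower_tail_lt1 r : 0 < r -> G r < 1.
Proof.
move=> r0; rewrite ltNge; apply/negP => G1.
have mb : measurable [set w | r < - X 0%N w].
  by apply: measurable_set_pred; apply: measurable_fun_ltr => //; exact: measurableT_comp.
have null : P (~` [set w | r < - X 0%N w]) = 0%E.
  rewrite probability_setC // (lower_tailE Xc 0).
  apply/eqP; rewrite eq_le; apply/andP; split; first by rewrite -EFinB lee_fin subr_le0.
  by rewrite -(lower_tailE Xc 0) -probability_setC //.
have := mean_positive_part (integrable_step Xc 0) (integral_step Xc 0).
have -> : mean P (fun w => `|X 0%N w|) = (absmean X 1)%:E.
  exact: mean_norm_step.
have -> : mean P (fun w => Num.max (X 0%N w) 0) = 0%E.
  rewrite /mean (ge0_negligible_integral (measurableC mb)) //.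
  - apply: integral0_eq => w [_ /= /contrapT lt].
    by rewrite max_r //; lra.
  - by apply/measurable_EFinP; exact: measurable_maxr.
  - by move=> w _; rewrite lee_fin le_max lexx orbT.
by rewrite mule0 => -[] E; move: X1; rewrite -E ltxx.
Qed.

(* [C] vanishes for [q = 0], since [0^-1 = 0]: the second term of the decay
   assumption then plays no role. *)
Definition persist_const (K L theta r q : R) : R :=
  let K' := Num.max K 1 in let L' := Num.max L 0 in
  let C := q^-1 / (1 - q `^ (theta * r) / q) in
  let D := (1 - q `^ (theta * (2 * r * q)))^-1 in
  Num.max 1 (2 * K' * (2 * K' + 2 * K' * L' * D * C + L' * D * C ^+ 2)).

Lemma absmean_le_sum_persist (K L theta r : R) n :
  0 < r -> 1 / r < theta -> tail_decay (X 0%N) K L theta r ->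
  absmean X n.+1 <= persist_const K L theta r (lower_tail (X 0%N) r) * absmean X 1
    * \sum_(i < n.+1) persist X i * persist X (n - i).
Proof.
move=> r0 rtheta decay.
have theta0 : 0 < theta by apply: lt_trans rtheta; rewrite divr_gt0.
have rt1 : 1 < theta * r by rewrite -ltr_pdivrMr.
rewrite /persist_const -/(G r); set q := G r.
set K' := Num.max K 1; set L' := Num.max L 0.
set C := q^-1 / _; set D := (1 - _)^-1.
have q1 : q < 1 by exact: lower_tail_lt1.
have q0 : 0 <= q by exact: lower_tail_ge0.
have K'1 : 1 <= K' by rewrite le_max lexx orbT.
have L'0 : 0 <= L' by rewrite le_max lexx orbT.
(* For [q = 0] the weight vanishes even at [t = 0], where the power would be 1. This keeps [e]
   monotone and fits [C = D = 0]. Agreement with the power is needed at positive arguments only,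
   since [Gdec] is reached through right limits. *)
pose e (t : R) : R := if q == 0 then 0 else expR (theta * t * ln q).
have e_ge0 t : 0 <= e t by rewrite /e; case: ifP => // _; exact: expR_ge0.
have lnq : ln q <= 0 by exact: ln_le0 (ltW q1).
have e_dec t s : t <= s -> e s <= e t.
  move=> ts; rewrite /e; case: ifP => // _; rewrite ler_expR.
  by rewrite ler_wnM2r // ler_wpM2l // ltW.
have eD t s : e (t + s) = e t * e s.
  rewrite /e; case: ifP => _; first by rewrite mul0r.
  by rewrite -expRD; congr expR; ring.
have me : measurable_fun setT e.
  apply: nonincreasing_measurable => //; exact: e_dec.
have powE t : 0 < t -> q `^ (theta * t) = e t.
  move=> t0; rewrite /powR /e; case: ifP => // _.
  by rewrite gt_eqF // mulr_gt0.
have q_cases : q = 0 \/ 0 < q by move: q0; rewrite le_eqVlt => /predU1P[<-|]; [left|right].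
have e_lt1 t : 0 < t -> e t < 1.
  move=> t0; rewrite /e; case: ifPn => // qn0; rewrite expR_lt1.
  have lnq0 : ln q < 0 by apply: ln_lt0; rewrite q1 lt_neqAle eq_sym qn0 q0.
  by rewrite pmulr_rlt0 // mulr_gt0.
(* This mesh serves twice. Markov's inequality with [E X_1^- = E|X_1| / 2] gives [K' * G h <= 1/2];
   at [r] it gives [2 r q <= h] because [K' >= 1], so [e h] is at most [e (2 r q)], which involves
   the law only through [q]. *)
set h := K' * absmean X 1.
have h0 : 0 < h by rewrite mulr_gt0 // (lt_le_trans ltr01).
have rqh : 2 * r * q <= h.
  have m : r * q <= 2^-1 * absmean X 1 := markov_lower_tail (ltW r0).
  by apply: le_trans (ler_peMl (ltW X1) K'1); lra.
have KGh : K' * G h <= 2^-1.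
  by rewrite -(ler_pM2r X1) mulrAC; exact: markov_lower_tail (ltW h0).
have Gdec t s : 0 <= t -> 0 <= s ->
    G (t + s) <= K' * G t * G s + L' * (e t * e s).
  move=> t0 s0; apply: (lower_tail_right_le Xc) => eps eps0.
  have e2 : 0 < eps / 2 by rewrite divr_gt0.
  have -> : t + s + eps = (t + eps / 2) + (s + eps / 2) by lra.
  have t1 : 0 < t + eps / 2 by rewrite ltr_wpDl.
  have s1 : 0 < s + eps / 2 by rewrite ltr_wpDl.
  apply: le_trans (decay _ _ t1 s1) _; rewrite -/(G _) -/(G _) -/(G r) -/q.
  have G0 x : 0 <= G x := lower_tail_ge0 X x.
  have Gt : G (t + eps / 2) <= G t by apply: (lower_tail_nonincreasing Xc); rewrite lerDl ltW.
  have Gs : G (s + eps / 2) <= G s by apply: (lower_tail_nonincreasing Xc); rewrite lerDl ltW.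
  apply: lerD.
    apply: (@le_trans _ _ (K' * G (t + eps / 2) * G (s + eps / 2))).
      by rewrite !ler_wpM2r // le_max lexx.
    by rewrite ler_pM // ?mulr_ge0 ?ler_wpM2l //; apply: le_trans K'1.
  rewrite (powE _ (addr_gt0 t1 s1)); apply: (@le_trans _ _ (L' * e (t + eps / 2 + (s + eps / 2)))).
    by rewrite ler_wpM2r // le_max lexx.
  rewrite ler_wpM2l // -eD e_dec //; lra.
have er_lt : 0 < q -> e r < q.
  move=> qp; rewrite /e gt_eqF // -[ltRHS]lnK // ltr_expR.
  by rewrite -[ltRHS]mul1r ltr_nM2r // ln_lt0 // qp q1.
have epow x l : 0 < q -> e (l%:R * x) = e x ^+ l.
  move=> qp; rewrite /e gt_eqF // -expRM_natl; congr expR; ring.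
have C0 : 0 <= C.
  have [qE|qp] := q_cases; first by rewrite /C qE invr0 mul0r.
  rewrite /C powE // mulr_ge0 ?invr_ge0 // subr_ge0 ler_pdivrMr // mul1r.
  exact: ltW (er_lt qp).
have D_eq : 0 < q -> D = (1 - e (2 * r * q))^-1.
  by move=> qp; rewrite /D powE // !mulr_gt0.
have D0 : 0 <= D.
  have [qE|qp] := q_cases; last first.
    by rewrite D_eq // invr_ge0 subr_ge0 ltW // e_lt1 // !mulr_gt0.
  by rewrite /D qE !mulr0 powRr0 subrr invr0.
have sum_e N : \sum_(l < N) e (l%:R * h) <= D.
  have [qE|qp] := q_cases.
    by rewrite big1 // => l _; rewrite /e qE eqxx.
  rewrite D_eq //; under eq_bigr do rewrite epow //.
  apply: sum_geometric_le => //; first exact: e_dec.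
  by rewrite e_lt1 // !mulr_gt0.
have mean_e m : (mean P (fun w => e (slope (block X (iota 0 m) w)))
    <= (C * persist X m)%:E)%E.
  have [qE|qp] := q_cases.
    have -> : (fun w => e (slope (block X (iota 0 m) w))) = fun=> 0.
      by apply/funext => w; rewrite /e qE eqxx.
    by rewrite mean_cst lee_fin mulr_ge0 // persist_ge0.
  rewrite /C powE //; apply: (mean_geometric_slope_le Xc) => //.
  - by move=> t s _; exact: e_dec.
  - by move=> l; exact: epow.
  - exact: er_lt.
  - exact: ltW.
have K'0 : 0 <= K' by apply: le_trans K'1.
have gapP i : (i < n.+1)%N -> (gap_mean X n i <=
    (h * (2 * K' + 2 * K' * L' * D * C + L' * D * C ^+ 2)
      * (persist X i * persist X (n - i)))%:E)%E.
  rewrite ltnS => lin; apply: (gap_mean_le_persist Xc K'0 L'0 h0 D0 C0 me e_ge0 _ _ _ KGh) => //.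
  by rewrite ltW // e_lt1.
set M := _ + _ in gapP *.
have pp0 i : 0 <= persist X i * persist X (n - i) by rewrite mulr_ge0 // persist_ge0.
rewrite -lee_fin; apply: le_trans (absmean_le_sum_gap Xc n) _.
apply: (@le_trans _ _ (2%:E * \sum_(i < n.+1) (h * M * (persist X i * persist X (n - i)))%:E)%E).
  by apply: lee_wpmul2l => //; apply: lee_sum => i _; exact: gapP.
rewrite sumEFin -EFinM lee_fin -mulr_sumr mulrA; apply: ler_wpM2r; first exact: sumr_ge0.
(* The 2 comes from [absmean_le_sum_gap], and [K'] with [absmean X 1] from [h]. The maximum with 1
   in [persist_const] keeps the constant positive for all parameters. *)
rewrite (_ : 2 * (h * M) = 2 * K' * M * absmean X 1); last by rewrite /h; ring.
by rewrite ler_wpM2r ?(ltW X1) // le_max lexx orbT.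
Qed.

End lower_bound.

(** * Rates *)

Section convolution_rate.
Variables (R : realType) (p rho : nat -> R) (c1 C2 : R).
Hypotheses (c1_gt0 : 0 < c1) (C2_gt0 : 0 < C2).
Hypotheses (p_ge0 : forall n, 0 <= p n) (rho_gt0 : forall n, 0 < rho n).
Hypothesis p_dec : forall m n, (m <= n)%N -> p n <= p m.
Hypothesis rho_inc : forall m n, (m <= n)%N -> rho m <= rho n.
Hypothesis upper : forall n, \sum_(k < n.+1) p k * p (n - k)%N <= c1 ^+ 2 * rho n.

(** By monotonicity each of the [n.+1] products in the convolution is at least [p n ^+ 2]. *)
Lemma rate_upper n : p n <= c1 * Num.sqrt (rho n / n.+1%:R).
Proof.
have n1 : (0 : R) < n.+1%:R by rewrite ltr0n.
have sq : p n ^+ 2 <= c1 ^+ 2 * (rho n / n.+1%:R).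
  rewrite mulrA ler_pdivlMr //; apply: le_trans (upper n).
  rewrite mulr_natr -[n.+1 in leLHS]card_ord -sumr_const.
  apply: ler_sum => k _; rewrite expr2 ler_pM //; apply: p_dec; last exact: leq_subr.
  by rewrite -ltnS.
rewrite -[leLHS]ger0_norm // -sqrtr_sqr -[c1]ger0_norm ?(ltW c1_gt0) // -sqrtr_sqr.
by rewrite -sqrtrM ?sqr_ge0 // ler_wsqrtr.
Qed.

Lemma sum_inv_sqrt_le n :
  \sum_(k < n) (Num.sqrt (k.+1%:R : R))^-1 <= 2 * Num.sqrt n%:R.
Proof.
elim: n => [|n IH]; first by rewrite big_ord0 sqrtr0 mulr0.
rewrite big_ord_recr /=; apply: le_trans (lerD IH (lexx _)) _.
have a0 : 0 <= Num.sqrt (n%:R : R) by exact: sqrtr_ge0.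
have b0 : 0 < Num.sqrt (n.+1%:R : R) by rewrite sqrtr_gt0 ltr0n.
have aE : Num.sqrt (n%:R : R) ^+ 2 = n%:R by rewrite sqr_sqrtr.
have bE : Num.sqrt (n.+1%:R : R) ^+ 2 = n%:R + 1 by rewrite sqr_sqrtr // natr1.
move: a0 b0 aE bE; set a := Num.sqrt _; set b := Num.sqrt _ => a0 b0 aE bE.
(* After multiplication by [b] the claim is [2 a b + 1 <= 2 b^2], which is [(a - b)^2 >= 0] because
   [b^2 = a^2 + 1]. *)
rewrite -(ler_pM2r b0) mulrDl mulVf ?gt_eqF //; nra.
Qed.

(** In each product one index is at least [n], so that factor is at most [p n]. Reflecting the upper
    half gives the lower one again without the middle term, whence the 2. *)
Lemma sum_le_half n :
  \sum_(k < (n + n).+1) p k * p (n + n - k)%N <= 2 * p n * \sum_(k < n.+1) p k.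
Proof.
have low k : (k <= n)%N -> p k * p (n + n - k)%N <= p n * p k.
  by move=> kn; rewrite mulrC ler_wpM2r // p_dec //; lia.
rewrite -(big_mkord xpredT (fun k => p k * p (n + n - k)%N)).
rewrite (@big_cat_nat _ _ _ n.+1) //=; last by rewrite ltnS leq_addr.
rewrite -mulrA mulrDl mul1r; apply: lerD.
  rewrite big_mkord mulr_sumr; apply: ler_sum => k _; apply: low.
  by rewrite -ltnS.
rewrite big_nat_rev /= (_ : \sum_(n.+1 <= k < (n + n).+1) _ =
  \sum_(n.+1 <= k < (n + n).+1) p (k - n.+1)%N * p (n + n - (k - n.+1))%N); last first.
  apply: eq_big_nat => k /andP[nk kn]; rewrite mulrC; congr (p _ * p _); lia.
rewrite -{1}[n.+1]add0n big_addn /= subSS addnK big_mkord.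
rewrite big_ord_recr /= mulrDr mulr_sumr -[leLHS]addr0; apply: lerD; last exact: mulr_ge0.
by apply: ler_sum => k _; rewrite addnK low // ltnW.
Qed.

Hypothesis lower : forall n, rho n <= C2 * \sum_(k < n.+1) p k * p (n - k)%N.

(** The lower bound is applied at [n + n], where [sum_le_half] isolates [p n]; the remaining sum is
    controlled by [rate_upper] and [sum_inv_sqrt_le]. Each of these two sums contributes a 2 to the
    4, and one factor [sqrt (rho n)] cancels. *)
Lemma rate_lower n : 1 / (4 * c1 * C2) * Num.sqrt (rho n / n.+1%:R) <= p n.
Proof.
set x := Num.sqrt (rho n); set y := Num.sqrt (n.+1%:R : R).
have x0 : 0 < x by rewrite sqrtr_gt0.
have y0 : 0 < y by rewrite sqrtr_gt0 ltr0n.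
have xE : x ^+ 2 = rho n by rewrite sqr_sqrtr // ltW.
have sum_p : \sum_(k < n.+1) p k <= c1 * x * (2 * y).
  apply: (@le_trans _ _ (c1 * x * \sum_(k < n.+1) (Num.sqrt (k.+1%:R : R))^-1)); last first.
    by rewrite ler_wpM2l ?sum_inv_sqrt_le // mulr_ge0 // ltW.
  rewrite mulr_sumr; apply: ler_sum => k _; apply: le_trans (rate_upper k) _.
  rewrite -mulrA ler_wpM2l ?(ltW c1_gt0) // sqrtrM ?(ltW (rho_gt0 _)) //.
  rewrite sqrtrV // ler_wpM2r ?invr_ge0 ?sqrtr_ge0 // ler_wsqrtr // rho_inc //.
  by rewrite -ltnS.
have main : x ^+ 2 <= C2 * (2 * p n * (c1 * x * (2 * y))).
  rewrite xE; apply: le_trans (rho_inc (leq_addr n n)) _.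
  apply: le_trans (lower _) _; rewrite ler_wpM2l ?(ltW C2_gt0) //.
  apply: le_trans (sum_le_half n) _; rewrite ler_wpM2l // mulr_ge0 //.
rewrite sqrtrM ?(ltW (rho_gt0 _)) // sqrtrV // -/x -/y.
rewrite mul1r mulrC ler_pdivrMr ?mulr_gt0 // ler_pdivrMr //.
rewrite -(ler_pM2l x0); apply: le_trans main _.
by rewrite le_eqVlt; apply/orP; left; apply/eqP; ring.
Qed.

End convolution_rate.

(** * Constants and final estimates *)

Section main.
Context (R : realType) d (T : measurableType d) (P : probability T R).
Variable X : nat -> {RV P >-> R}.
Hypothesis Xc : centered X.
Hypothesis X1 : 0 < absmean X 1.

(** The 2 compensates [E X_1^- = E|X_1| / 2]; [kappa] compares the mean range with the mean absolute
    end point. *)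
Lemma sum_wpersist_le n (kappa : R) :
  (mean P (fun w => run X n.+1 w + run (negX X) n.+1 w)%R <= (kappa * absmean X n.+1)%:E)%E ->
  \sum_(k < n.+1) wpersist X k * wpersist X (n - k)
    <= 2 * kappa * (absmean X n.+1 / absmean X 1).
Proof.
move=> range.
have gapP k : (k < n.+1)%N ->
    ((2^-1 * absmean X 1 * (wpersist X k * wpersist X (n - k)))%:E <= gap_mean X n k)%E.
  rewrite ltnS => kn; have := mean_max_ge Xc (uniq_split kn).
  rewrite size_rev !size_iota => h.
  have -> : gap_mean X n k = mean P (fun w => Num.max (- X k w
    - slope (block X (rev (iota 0 k)) w) - slope (block X (iota k.+1 (n - k)) w)) 0).
    by congr mean; apply/funext => w; exact: gap_split.
  by apply: le_trans h; rewrite mean_negative_part // -!EFinM.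
have sums : ((2^-1 * absmean X 1 * \sum_(k < n.+1) wpersist X k * wpersist X (n - k))%:E
    <= (kappa * absmean X n.+1)%:E)%E.
  apply: le_trans range; apply: le_trans (sum_gap_le_range_mean X n).
  by rewrite mulr_sumr -sumEFin; apply: lee_sum => k _; exact: gapP.
move: sums; rewrite lee_fin mulrA ler_pdivlMr // => h.
by set S := \sum_(k < _) _ in h *; lra.
Qed.

Lemma mean_ratioE n : mean_ratio X n = absmean X n / absmean X 1.
Proof.
rewrite /mean_ratio /absmean /abs_mean !unlock; congr (_ / fine _).
by congr mean; apply/funext => w; rewrite /psum big_nat1.
Qed.

Lemma absmean_negX n : absmean (negX X) n = absmean X n.
Proof.
by rewrite /absmean; congr fine; congr mean; apply/funext => w;
  rewrite psum_negX normrN.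
Qed.

Lemma wpersist_ge_persist_conv n :
  \sum_(k < n.+1) persist X k * persist X (n - k)
    <= \sum_(0 <= k < n.+1) persist X k * wpersist X (n - k).
Proof.
rewrite big_mkord; apply: ler_sum => k _.
by rewrite ler_wpM2l ?persist_ge0 // persist_le_wpersist.
Qed.

End main.

(* [c2] is chosen before the probability space and the sequence, hence depends
   on the law of X_1 only through the data of the decay assumption: the
   constants K, L, theta, r and the base P(-X_1 > r) of its last term.  The
   last argument cannot be dropped: the bound fails uniformly over laws with
   the same K, L, theta, r when P(-X_1 > r) tends to 1. *)
Theorem theorem1p2 (R : realType) :
  exists c2 : R -> R -> R -> R -> R -> R,
    (forall K L theta r q : R, 0 < c2 K L theta r q) /\
    forall (d : measure_display) (T : measurableType d) (P : probability T R)
      (X : nat -> {RV P >-> R}),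
      iid X ->
      (0 < abs_mean P (X 0%N))%E -> (abs_mean P (X 0%N) < +oo)%E ->
      ('E_P[X 0%N] = 0)%E ->
      exists c1 : R,
        [/\ 0 < c1,
            c1 <= 6 * Num.sqrt 30,
            symmetric_rv (X 0%N) -> c1 = 2,
            forall n : nat, (1 <= n)%N ->
              \sum_(0 <= k < n.+1) persist X k * wpersist X (n - k)
                <= c1 ^+ 2 * mean_ratio X n.+1
          & forall K L theta r : R,
              0 < r -> 1 / r < theta -> tail_decay (X 0%N) K L theta r ->
              let C2 := c2 K L theta r (lower_tail (X 0%N) r) in
              (forall n : nat, (1 <= n)%N ->
                 1 / C2 * mean_ratio X n.+1
                   <= \sum_(0 <= k < n.+1) persist X k * persist X (n - k))
              /\
              (forall n : nat, (1 <= n)%N ->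
                 1 / (4 * c1 * C2) * Num.sqrt (mean_ratio X n.+1 / n.+1%:R)
                   <= persist X n
                 /\ persist X n
                   <= c1 * Num.sqrt (mean_ratio X n.+1 / n.+1%:R))].
Proof.
exists (@persist_const R); split.
  by move=> K L theta r q; rewrite (lt_le_trans ltr01) // le_max lexx.
move=> d T P X Xiid; rewrite /abs_mean unlock => X1 Xfin X0.
have Xc : centered X by split.
have A1 : 0 < absmean X 1 by rewrite -lte_fin -(mean_norm_step Xc 0).
(* Here [c1 ^+ 2] is [2 * kappa], with [kappa] from [mean_range_le]: it is 2 for symmetric steps,
   where [c = 0], and [2 + 4 * 2 = 10] in general, where [c] is twice [absmean X n.+1]. *)
pose c1 : R := if `[< symmetric_rv (X 0%N) >] then 2 else Num.sqrt 20.
have c1_gt0 : 0 < c1 by rewrite /c1; case: ifP => // _; rewrite sqrtr_gt0.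
have Agt0 n : 0 < absmean X n.+1.
  by apply: lt_le_trans A1 _; apply: absmean_mono.
have conv_le n : \sum_(0 <= k < n.+1) persist X k * wpersist X (n - k)
    <= c1 ^+ 2 * mean_ratio X n.+1.
  apply: (@le_trans _ _ (\sum_(k < n.+1) wpersist X k * wpersist X (n - k))).
    rewrite big_mkord; apply: ler_sum => k _; rewrite ler_wpM2r ?persist_le_wpersist //.
    by apply: le_trans (persist_le_wpersist _ _); exact: persist_ge0.
  rewrite mean_ratioE /c1; case: asboolP => [sym|_].
    rewrite (_ : 2 ^+ 2 = 2 * 2); last by rewrite expr2.
    apply: sum_wpersist_le => //.
    rewrite (_ : 2 * _ = 2 * absmean X n.+1 + 4 * 0); last by rewrite mulr0 addr0.
    apply: mean_range_le => //.
      by move=> j jn; exact: half_le_prob_symmetric.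
    move=> j jn; apply: half_le_prob_symmetric => //; first exact: centered_negX.
    move=> A mA; rewrite (_ : (fun w => _) = X 0%N :> (T -> R)).
      by rewrite -[RHS]/(distribution P (X 0%N) A) sym.
    by apply/funext => w; rewrite /= opprK.
  rewrite sqr_sqrtr // (_ : 20 = 2 * 10); last by ring.
  apply: sum_wpersist_le => //.
  rewrite (_ : 10 * _ = 2 * absmean X n.+1 + 4 * (2 * absmean X n.+1)); last by ring.
  have c0 : 0 < 2 * absmean X n.+1 by rewrite mulr_gt0.
  apply: mean_range_le => //; first exact: ltW.
    by move=> j jn; exact: (half_le_prob Xc c0).
  move=> j jn; apply: (half_le_prob (centered_negX Xc) c0) => //.
  by rewrite absmean_negX.
have rho_gt0 n : 0 < mean_ratio X n.+1 by rewrite mean_ratioE divr_gt0.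
have rho_inc m n : (m <= n)%N -> mean_ratio X m.+1 <= mean_ratio X n.+1.
  by move=> mn; rewrite !mean_ratioE ler_wpM2r ?invr_ge0 ?(ltW A1) // absmean_mono.
exists c1; split => //.
- have s30 : 1 <= Num.sqrt (30 : R).
    by rewrite -[leLHS]sqrtr1 ler_wsqrtr // ler1n.
  rewrite /c1; case: ifP => _; first by lra.
  apply: (@le_trans _ _ (Num.sqrt 30)); last by lra.
  by rewrite ler_wsqrtr // ler_nat.
- by rewrite /c1 => sym; case: asboolP.
- move=> K L theta r r0 rtheta decay.
  set C2 := persist_const _ _ _ _ _.
  have C2_gt0 : 0 < C2 by rewrite (lt_le_trans ltr01) // le_max lexx.
  have lower n : mean_ratio X n.+1 <= C2 * \sum_(k < n.+1) persist X k * persist X (n - k).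
    rewrite mean_ratioE ler_pdivrMr // mulrAC.
    exact: absmean_le_sum_persist.
  have upper n : \sum_(k < n.+1) persist X k * persist X (n - k)
      <= c1 ^+ 2 * mean_ratio X n.+1.
    exact: le_trans (wpersist_ge_persist_conv X n) (conv_le n).
  have pdec m n : (m <= n)%N -> persist X n <= persist X m.
    exact: persist_nonincreasing.
  split=> n _.
    by rewrite mul1r mulrC ler_pdivrMr // mulrC big_mkord.
  split.
    exact: (rate_lower c1_gt0 C2_gt0 (persist_ge0 X) rho_gt0 pdec rho_inc upper lower).
  exact: (rate_upper c1_gt0 (persist_ge0 X) pdec upper).
Qed.
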